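(* Let $\mathbf{X}$ be a Köthe reflexive $\mathbf{F}^n$-directional Banach function space over $\mathbf{R}^d$ for which both $\mathbf{X}$ and $\mathbf{X}'$ satisfy the component-wise saturation property. Consider the following statements: (a) $M^{\mathcal{K}}:\mathbf{X}[\mathcal{K}]\to\mathbf{X}[\mathcal{K}]$; (b) $\mathbf{X}\in A_{\mathrm{strong}}$; (c) $M:\mathbf{X}[\mathcal{K}]\to\mathbf{X}_{\mathrm{weak}}[\mathcal{K}]$; (d) $\mathbf{X}\in A$. Then (a)$\Rightarrow$(b)$\Rightarrow$(c)$\Rightarrow$(d) with $$[\mathbf{X}]_{A}\leq\|M\|_{\mathbf{X}[\mathcal{K}]\to\mathbf{X}_{\mathrm{weak}}[\mathcal{K}]}\leq C_{d,n}[\mathbf{X}]_{A_{\mathrm{strong}}},\qquad [\mathbf{X}]_{A_{\mathrm{strong}}}\leq\|M^{\mathcal{K}}\|_{\mathbf{X}[\mathcal{K}]\to\mathbf{X}[\mathcal{K}]},$$ where $C_{d,n}$ depends only on $d$ and $n$. Furthermore, if there is a $C\geq 1$ such that for all pairwise disjoint collections of cubes $\mathcal{P}$ and all $f\in\mathbf{X}$, $g\in\mathbf{X}'$ we have $$\sum_{Q\in\mathcal{P}}\|\mathbf{1}_Q f\|_{\mathbf{X}}\|\mathbf{1}_Q g\|_{\mathbf{X}'}\leq C\|f\|_{\mathbf{X}}\|g\|_{\mathbf{X}'},$$ then (b), (c) and (d) are equivalent, and the three quantities $[\mathbf{X}]_{A_{\mathrm{strong}}}$, $\|M\|_{\mathbf{X}[\mathcal{K}]\to\mathbf{X}_{\mathrm{weak}}[\mathcal{K}]}$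 and $[\mathbf{X}]_A$ are comparable, with comparability constants depending only on $d$, $n$ and $C$.
   Context: **Basic notation.** $d,n\ge 1$ are fixed integers, $\mathbf{F}$ is $\mathbf{R}$ or $\mathbf{C}$, $u\cdot v=\sum_{k=1}^n u_k\overline{v_k}$ on $\mathbf{F}^n$, $(e_k)_{k=1}^n$ is the standard basis. $L^0(\mathbf{R}^d;\mathbf{F}^n)$ is the space of measurable functions $\mathbf{R}^d\to\mathbf{F}^n$ (modulo a.e. equality; Lebesgue measure). A cube is a cube in $\mathbf{R}^d$ with sides parallel to the coordinate axes. **Convex-set valued maps.** $\mathcal{K}$ is the collection of non-empty closed convex $K\subseteq\mathbf{F}^n$ that are symmetric: $\lambda u\in K$ for $u\in K$, $\lambda\in\mathbf{F}$, $|\lambda|=1$. For $u\in\mathbf{F}^n$, $\mathcal{K}(u)=\{\lambda u:|\lambda|\le1\}$, and for a function $f$, $\mathcal{K}(f)(x):=\mathcal{K}(f(x))$. $L^0(\mathbf{R}^d;\mathcal{K})$ is the set of $F:\mathbf{R}^d\to\mathcal{K}$ such that $\{x:F(x)\cap E\ne\emptyset\}$ is measurable for every measurable (equivalently, every open) $E\subseteq\mathbf{F}^n$. $S^0(\mathbf{R}^d;F)$ is the set of $f\in L^0(\mathbf{R}^d;\mathbf{F}^n)$ with $f(x)\in F(x)$ a.e. **Directional Banach function spaces.** An $\mathbf{F}^n$-directional Banach function space $\mathbf{X}$ over $\mathbf{R}^d$ is a complete normed subspace of $L^0(\mathbf{R}^d;\mathbf{F}^n)$ with: (directional ideal property) if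 $f\in\mathbf{X}$, $g\in L^0(\mathbf{R}^d;\mathbf{F}^n)$ and $\mathcal{K}(g)(x)\subseteq\mathcal{K}(f)(x)$ a.e., then $g\in\mathbf{X}$ and $\|g\|_{\mathbf{X}}\le\|f\|_{\mathbf{X}}$; (non-degeneracy) if $g\in L^0(\mathbf{R}^d;\mathbf{F}^n)$ and $\int f\cdot g\,dx=0$ for all $f\in\mathbf{X}$, then $g=0$ a.e. Its Köthe dual $\mathbf{X}'$ consists of the $g\in L^0(\mathbf{R}^d;\mathbf{F}^n)$ with $\|g\|_{\mathbf{X}'}:=\sup_{\|f\|_{\mathbf{X}}=1}\int|f\cdot g|\,dx<\infty$; $\mathbf{X}$ is Köthe reflexive if $\mathbf{X}''=\mathbf{X}$ with equal norm. $\mathbf{X}$ satisfies the component-wise saturation property if for every $k\in\{1,\dots,n\}$ and every $E\subseteq\mathbf{R}^d$ with $|E|>0$ there is $G\subseteq E$ with $|G|>0$ and $\mathbf{1}_Ge_k\in\mathbf{X}$. $\mathbf{X}[\mathcal{K}]$ is the set of $F\in L^0(\mathbf{R}^d;\mathcal{K})$ for which $S^0(\mathbf{R}^d;F)$ is a bounded subset of $\mathbf{X}$, with $\|F\|_{\mathbf{X}[\mathcal{K}]}:=\sup_{f\in S^0(\mathbf{R}^d;F)}\|f\|_{\mathbf{X}}$. **Maximal operators.** $L^1_{\mathrm{loc}}(\mathbf{R}^d;\mathcal{K})$ is the set of $F\in L^0(\mathbf{R}^d;\mathcal{K})$ such that for each cube $Q$ the set $S^0(\mathbf{R}^d;F\mathbf{1}_Q)$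 is bounded in $L^1(\mathbf{R}^d;\mathbf{F}^n)$, where $F\mathbf{1}_Q$ equals $F$ on $Q$ and $\{0\}$ off $Q$. For such $F$, $\langle F\rangle_Q:=\{\frac1{|Q|}\int_Qf\,dx:f\in S^0(\mathbf{R}^d;F\mathbf{1}_Q)\}$, $MF(x):=\overline{\bigcup_{Q\ni x}\langle F\rangle_Q}$ (all cubes $Q$ containing $x$), and $M^{\mathcal{K}}F(x)$ is the smallest set in $\mathcal{K}$ containing $MF(x)$. $M^{\mathcal{K}}:\mathbf{X}[\mathcal{K}]\to\mathbf{X}[\mathcal{K}]$ means that $\mathbf{X}[\mathcal{K}]\subseteq L^1_{\mathrm{loc}}(\mathbf{R}^d;\mathcal{K})$ and $\|M^{\mathcal{K}}F\|_{\mathbf{X}[\mathcal{K}]}\le c\|F\|_{\mathbf{X}[\mathcal{K}]}$ for all $F$ with some $c<\infty$; the smallest $c$ is $\|M^{\mathcal{K}}\|_{\mathbf{X}[\mathcal{K}]\to\mathbf{X}[\mathcal{K}]}$. $M:\mathbf{X}[\mathcal{K}]\to\mathbf{X}_{\mathrm{weak}}[\mathcal{K}]$ means that $\mathbf{X}[\mathcal{K}]\subseteq L^1_{\mathrm{loc}}(\mathbf{R}^d;\mathcal{K})$ and there is $c>0$ with $$\sup_{u\in\mathbf{F}^n}\|\mathbf{1}_{\{x\in\mathbf{R}^d:u\in MF(x)\}}u\|_{\mathbf{X}}\le c\|F\|_{\mathbf{X}[\mathcal{K}]}\quad\text{for all }F\in\mathbf{X}[\mathcal{K}];$$ the smallest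 $c$ is $\|M\|_{\mathbf{X}[\mathcal{K}]\to\mathbf{X}_{\mathrm{weak}}[\mathcal{K}]}$. **Muckenhoupt conditions.** For a pairwise disjoint collection of cubes $\mathcal{P}$, $T_{\mathcal{P}}f:=\sum_{Q\in\mathcal{P}}\langle f\rangle_Q\mathbf{1}_Q$ with $\langle f\rangle_Q=\frac1{|Q|}\int_Qf\,dx$; $T_Q:=T_{\{Q\}}$. Writing $T_{\mathcal{P}}:\mathbf{X}\to\mathbf{X}$ means every $f\in\mathbf{X}$ is integrable over each $Q\in\mathcal{P}$ and $T_{\mathcal{P}}$ is bounded on $\mathbf{X}$. $\mathbf{X}\in A$ (resp. $\mathbf{X}\in A_{\mathrm{strong}}$) means $\mathbf{1}_Qu\in\mathbf{X}$ and $\mathbf{1}_Qu\in\mathbf{X}'$ for all cubes $Q$ and $u\in\mathbf{F}^n$, and $[\mathbf{X}]_A:=\sup_Q\|T_Q\|_{\mathbf{X}\to\mathbf{X}}<\infty$ over all cubes $Q$ (resp. $[\mathbf{X}]_{A_{\mathrm{strong}}}:=\sup_{\mathcal{P}}\|T_{\mathcal{P}}\|_{\mathbf{X}\to\mathbf{X}}<\infty$ over all pairwise disjoint collections of cubes $\mathcal{P}$). *)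

(* Defs.v *)
From HB Require Import structures.
From mathcomp Require Import all_boot all_order all_algebra.
From mathcomp Require Import complex.
From mathcomp Require Import all_classical all_reals all_analysis.

Set Implicit Arguments.
Unset Strict Implicit.
Unset Printing Implicit Defensive.

Import Order.TTheory GRing.Theory Num.Theory.
Import numFieldNormedType.Exports.

Local Open Scope classical_set_scope.
Local Open Scope ring_scope.

(* Lebesgue measure on R^d: first the d-fold product of [lebesgue_measure] on
   the product (= Borel) sigma-algebra of [d.-tuple R], then its Caratheodory
   extension.  The completion matters: [M_op] below involves unions of
   uncountably many cubes, which are Lebesgue but not always Borel sets. *)

Definition tcons (R : realType) (d : nat)
    (p : measurableTypeR R * d.-tuple (measurableTypeR R)) :
  d.+1.-tuple (measurableTypeR R) := [tuple of p.1 :: p.2].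

Lemma measurable_tcons (R : realType) (d : nat) :
  measurable_fun [set: _] (@tcons R d).
Proof. exact: measurable_cons. Qed.

Section borel_lebesgue_step.
Context (R : realType) (d : nat).
Variable mu : {sigma_finite_measure set (d.-tuple (measurableTypeR R)) -> \bar R}.

Definition borel_lebesgue_succ : set (d.+1.-tuple (measurableTypeR R)) -> \bar R :=
  pushforward (@lebesgue_measure R \x mu)%E (@tcons R d).

HB.instance Definition _ := Measure.copy borel_lebesgue_succ
  (measure_function_pushforward__canonical__measure_function_Measure
    (@lebesgue_measure R \x mu)%E (@measurable_tcons R d)).

Lemma borel_lebesgue_succ_sigma_finite :
  sigma_finite [set: _] borel_lebesgue_succ.
Proof.
have /sigma_finiteP[F [FT ndF Foo]] := sigma_finiteT (@lebesgue_measure R).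
have /sigma_finiteP[G [GT ndG Goo]] := sigma_finiteT mu.
pose h (t : d.+1.-tuple (measurableTypeR R)) :
    measurableTypeR R * d.-tuple (measurableTypeR R) :=
  (thead t, [tuple of behead t]).
have hK : cancel (@tcons R d) h.
  by move=> [a t]; rewrite /h /tcons/= theadE; congr (_, _); apply/val_inj.
have mh : measurable_fun [set: _] h.
  apply/measurable_fun_pairP; split.
    exact: (measurable_tnth ord0).
  exact: measurable_behead.
exists (fun k => h @^-1` (F k `*` G k)).
  apply/esym/seteqP; split=> // t _.
  have [n _ Fn] : (\bigcup_n F n) (h t).1 by rewrite -FT.
  have [m _ Gm] : (\bigcup_n G n) (h t).2 by rewrite -GT.
  exists (maxn n m) => //; split.
    by move: Fn; exact/subsetPset/ndF/leq_maxl.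
  by move: Gm; exact/subsetPset/ndG/leq_maxr.
move=> k; have [mF Fk] := Foo k; have [mG Gk] := Goo k; split.
  by rewrite -[X in measurable X]setTI; apply: mh => //; exact: measurableX.
rewrite /borel_lebesgue_succ /pushforward (_ : _ @^-1` _ = F k `*` G k).
  by rewrite product_measure1E// lte_mul_pinfty// ge0_fin_numE.
rewrite -comp_preimage (_ : h \o _ = id)//.
by apply/funext => x; exact: hK.
Qed.

HB.instance Definition _ := Measure_isSigmaFinite.Build _ _ _
  borel_lebesgue_succ borel_lebesgue_succ_sigma_finite.

End borel_lebesgue_step.

Definition borel_lebesgue_zero (R : realType) :
  set (0.-tuple (measurableTypeR R)) -> \bar R := dirac [tuple].
HB.instance Definition _ (R : realType) := Measure.on (@borel_lebesgue_zero R).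
HB.instance Definition _ (R : realType) :=
  SigmaFiniteMeasure.on (@borel_lebesgue_zero R).

Fixpoint borel_lebesgue (R : realType) (d : nat) :
    {sigma_finite_measure set (d.-tuple (measurableTypeR R)) -> \bar R} :=
  if d is d'.+1 then borel_lebesgue_succ (borel_lebesgue R d')
  else @borel_lebesgue_zero R.

Definition Rd (R : realType) (d : nat) : measurableType _ :=
  caratheodory_type (mu_ext (borel_lebesgue R d)).

Definition Leb (R : realType) (d : nat) : {measure set (Rd R d) -> \bar R} :=
  @completed_measure_extension _ _ _ (borel_lebesgue R d).

(* Nondegenerate, axis-parallel; each face may or may not belong to the cube,
   so that open, closed and half-open cubes are all covered. *)
Definition cube (R : realType) (d : nat) : set (set (Rd R d)) :=
  [set Q | exists (a : d.-tuple R) (l : R) (b c : 'I_d -> bool), 0 < l /\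
    Q = [set x : d.-tuple R | forall i, tnth x i \in
           Interval (BSide (b i) (tnth a i)) (BSide (c i) (tnth a i + l))]].

Definition cube_family (R : realType) (d : nat) : set (set (set (Rd R d))) :=
  [set P | P `<=` @cube R d /\ trivIset P id].

Variant scalars := RealScalars | ComplexScalars.

Definition scal (R : realType) (F : scalars) : numFieldType :=
  match F with RealScalars => R | ComplexScalars => R[i] end.

Definition sre (R : realType) (F : scalars) : scal R F -> R :=
  match F with
  | RealScalars => fun z : R => z
  | ComplexScalars => fun z : R[i] => complex.Re z
  end.

Definition sim (R : realType) (F : scalars) : scal R F -> R :=
  match F with
  | RealScalars => fun=> 0
  | ComplexScalars => fun z : R[i] => complex.Im z
  end.

(* a + i b, the imaginary part being dropped over the reals. *)
Definition smk (R : realType) (F : scalars) : R -> R -> scal R F :=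
  match F with
  | RealScalars => fun a _ => a
  | ComplexScalars => fun a b => (a +i* b)%C
  end.

Definition sconj (R : realType) (F : scalars) (z : scal R F) : scal R F :=
  smk F (sre z) (- sim z).

(* MathComp's norm on [scal R F] takes its values in [scal R F]. *)
Definition sabs (R : realType) (F : scalars) (z : scal R F) : R := sre `|z|.

Section directional.
Context (R : realType) (F : scalars) (d n : nat).
Local Notation K := (scal R F).
Local Notation Fn := 'rV[scal R F]_n.
Local Notation Rd := (Rd R d).
Local Notation mu := (Leb R d).
Implicit Types (f g : Rd -> Fn) (A : set Fn) (Phi : Rd -> set Fn).
Implicit Types (Q G E : set Rd) (P : set (set Rd)) (u v : Fn).

Definition dot u v : K := \sum_(k < n) u 0 k * sconj (v 0 k).

Definition vabs u : R := Num.sqrt (\sum_(k < n) sabs (u 0 k) ^+ 2).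

(* Functions are not quotiented by a.e. equality. *)
Definition L0 : set (Rd -> Fn) :=
  [set f | forall U : set Fn, open U -> measurable (f @^-1` U)].

Definition cutoff G f : Rd -> Fn := fun x => (\1_G x : K) *: f x.

Definition sint E (h : Rd -> K) : K :=
  smk F (\int[mu]_(x in E) sre (h x)) (\int[mu]_(x in E) sim (h x)).

Definition vint E f : Fn := \row_k sint E (fun x => f x 0 k).

Definition vintegrable E f := mu.-integrable E (fun x => (vabs (f x))%:E).

Definition avg Q f : Fn := smk F (fine (mu Q))^-1 0 *: vint Q f.

Definition Ku u : set Fn := [set l *: u | l in [set l : K | `|l| <= 1]].

(* A convex combination with weights in [scal R F] between 0 and 1 has real
   weights, so over the complex scalars this is still real convexity. *)
Definition Kset : set (set Fn) :=
  [set A | [/\ A !=set0, closed A, @convex_set K Fn A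
             & forall (l : K) u, `|l| = 1 -> A u -> A (l *: u)]].

Definition L0K : set (Rd -> set Fn) :=
  [set Phi | (forall x, Kset (Phi x)) /\
     forall U : set Fn, open U -> measurable [set x | Phi x `&` U !=set0]].

Definition S0 Phi : set (Rd -> Fn) :=
  [set f | L0 f /\ {ae mu, forall x, Phi x (f x)}].

(* A candidate normed space of functions; [fnorm] is irrelevant off [fcar]. *)
Record fspace := FSpace {
  fcar : set (Rd -> Fn) ;
  fnorm : (Rd -> Fn) -> R }.

Implicit Types X : fspace.

(* Closure of [fcar X] under a.e. equality, and invariance of the norm under
   it, are instances of the directional ideal property. *)
Record directional_BFS X : Prop := DirectionalBFS {
  dbfs_L0 : fcar X `<=` L0 ;
  dbfs_zero : fcar X (cst 0) ;
  dbfs_add : forall f g, fcar X f -> fcar X g -> fcar X (f \+ g) ;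
  dbfs_scale : forall (l : K) f, fcar X f -> fcar X (fun x => l *: f x) ;
  dbfs_norm_ge0 : forall f, fcar X f -> 0 <= fnorm X f ;
  dbfs_normD : forall f g, fcar X f -> fcar X g ->
    fnorm X (f \+ g) <= fnorm X f + fnorm X g ;
  dbfs_normZ : forall (l : K) f, fcar X f ->
    fnorm X (fun x => l *: f x) = sabs l * fnorm X f ;
  dbfs_norm_eq0 : forall f, fcar X f -> fnorm X f = 0 ->
    {ae mu, forall x, f x = 0} ;
  dbfs_complete : forall s : nat -> Rd -> Fn, (forall k, fcar X (s k)) ->
    (forall e : R, 0 < e -> exists m : nat, forall i j,
       (m <= i)%N -> (m <= j)%N -> fnorm X (s i \- s j) < e) ->
    exists2 f, fcar X f & fnorm X (s k \- f) @[k --> \oo] --> (0 : R) ;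
  dbfs_ideal : forall f g, fcar X f -> L0 g ->
    {ae mu, forall x, Ku (g x) `<=` Ku (f x)} ->
    fcar X g /\ fnorm X g <= fnorm X f ;
  dbfs_nondegenerate : forall g, L0 g ->
    (forall f, fcar X f ->
       mu.-integrable setT (fun x => (sabs (dot (f x) (g x)))%:E) /\
       sint setT (fun x => dot (f x) (g x)) = 0) ->
    {ae mu, forall x, g x = 0} }.

Definition dual_norm X g : \bar R :=
  ereal_sup [set (\int[mu]_x (sabs (dot (f x) (g x)))%:E)%E
            | f in [set f | fcar X f /\ fnorm X f = 1]].

Definition kothe_dual X : fspace :=
  FSpace [set g | L0 g /\ (dual_norm X g < +oo)%E]
         (fun g => fine (dual_norm X g)).

Definition kothe_reflexive X : Prop :=
  fcar (kothe_dual (kothe_dual X)) = fcar X /\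
  forall f, fcar X f -> fnorm (kothe_dual (kothe_dual X)) f = fnorm X f.

Definition saturated X : Prop :=
  forall (k : 'I_n) E, measurable E -> (0 < mu E)%E ->
    exists G, [/\ measurable G, G `<=` E, (0 < mu G)%E
                & fcar X (cutoff G (cst (delta_mx 0 k)))].

Definition XK X : set (Rd -> set Fn) :=
  [set Phi | L0K Phi /\
     exists c : R, forall f, S0 Phi f -> fcar X f /\ fnorm X f <= c].

Definition XKnorm X Phi : \bar R :=
  ereal_sup [set (fnorm X f)%:E | f in S0 Phi].

Definition cutoffK Q Phi : Rd -> set Fn :=
  fun x => if x \in Q then Phi x else [set 0].

Definition L1locK : set (Rd -> set Fn) :=
  [set Phi | L0K Phi /\ forall Q, cube Q ->
     exists c : R, forall f, S0 (cutoffK Q Phi) f ->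
       (\int[mu]_x (vabs (f x))%:E <= c%:E)%E].

Definition avgK Q Phi : set Fn := avg Q @` S0 (cutoffK Q Phi).

Definition M_op Phi : Rd -> set Fn :=
  fun x => closure (\bigcup_(Q in [set Q | cube Q /\ Q x]) avgK Q Phi).

Definition MK_op Phi : Rd -> set Fn := fun x => smallest Kset (M_op Phi x).

Definition MK_bound X : set R :=
  [set c | [/\ 0 <= c, XK X `<=` L1locK
             & forall Phi, XK X Phi -> XK X (MK_op Phi) /\
                 (XKnorm X (MK_op Phi) <= c%:E * XKnorm X Phi)%E]].

Definition MK_bounded X : Prop := MK_bound X !=set0.

(* Operator norms and Muckenhoupt constants are extended-real, with the value
   +oo when the operator in question is not bounded. *)
Definition MK_norm X : \bar R := ereal_inf [set c%:E | c in MK_bound X].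

Definition Mweak_bound X : set R :=
  [set c | [/\ 0 < c, XK X `<=` L1locK
             & forall Phi, XK X Phi ->
                 (forall u, fcar X (cutoff [set x | M_op Phi x u] (cst u))) /\
                 (ereal_sup (range (fun u =>
                    (fnorm X (cutoff [set x | M_op Phi x u] (cst u)))%:E))
                  <= c%:E * XKnorm X Phi)%E]].

Definition Mweak_bounded X : Prop := Mweak_bound X !=set0.

Definition Mweak_norm X : \bar R := ereal_inf [set c%:E | c in Mweak_bound X].

(* For a pairwise disjoint [P] the sum has at most one nonzero term. *)
Definition T_op P f : Rd -> Fn :=
  fun x => \sum_(Q \in P) (\1_Q x : K) *: avg Q f.

Definition T_bound X P : set R :=
  [set c | 0 <= c /\ forall f, fcar X f ->
     [/\ forall Q, P Q -> vintegrable Q f, fcar X (T_op P f)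
       & fnorm X (T_op P f) <= c * fnorm X f]].

Definition T_norm X P : \bar R := ereal_inf [set c%:E | c in T_bound X P].

Definition A_const X : \bar R :=
  ereal_sup [set T_norm X [set Q] | Q in @cube R d].

Definition Astrong_const X : \bar R :=
  ereal_sup [set T_norm X P | P in @cube_family R d].

Definition has_cube_indicators X : Prop :=
  forall Q u, cube Q ->
    fcar X (cutoff Q (cst u)) /\ fcar (kothe_dual X) (cutoff Q (cst u)).

Definition in_A X : Prop := has_cube_indicators X /\ (A_const X < +oo)%E.

Definition in_Astrong X : Prop :=
  has_cube_indicators X /\ (Astrong_const X < +oo)%E.

Definition cube_sum_bound X (C : R) : Prop :=
  forall P f g, cube_family P -> fcar X f -> fcar (kothe_dual X) g ->
    (\esum_(Q in P) (fnorm X (cutoff Q f) *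
                     fnorm (kothe_dual X) (cutoff Q g))%:E
     <= (C * fnorm X f * fnorm (kothe_dual X) g)%:E)%E.

End directional.

Definition comparable_by (R : realType) (c : R) (a b : \bar R) : Prop :=
  (a <= c%:E * b)%E /\ (b <= c%:E * a)%E.

(* Main.v *)
Require Import Defs.
From mathcomp Require Import all_boot all_order all_algebra.
From mathcomp Require Import complex.
From mathcomp Require Import all_classical all_reals all_analysis.
From mathcomp Require Import measurable_realfun.
From mathcomp Require Import ring lra zify.

Set Implicit Arguments.
Unset Strict Implicit.
Unset Printing Implicit Defensive.

Import Order.TTheory GRing.Theory Num.Theory.
Import numFieldNormedType.Exports.

Local Open Scope classical_set_scope.
Local Open Scope ring_scope.

(** Write K(f) for the set-valued map sending x to K(f(x)), whose norm in X[K] is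
    at most that of f by the ideal property, and T for the averaging operator of
    a disjoint family of cubes.

    From maximal to averaging operators, the operators are tested on F = K(f).
    The average of f over Q belongs to M F at every point of Q.  As 0 belongs to
    every set of the class K, T f is a selection of M^K F, which gives (b) from
    (a) with the same constant ([MK_bound_T_bound]).  For a single cube the
    constant value u of T f on Q lies in M F on all of Q, so T f is dominated by
    the function that the weak-type estimate controls ([Mweak_bound_T_bound]).
    The indicators required in condition A come from the boundedness of the
    averages alone: averaging 1_G e_k over Q produces a multiple of 1_Q e_k, and
    1_G e_k in X' bounds the k-th coordinate of v by the norm of 1_Q v, hence
    bounds the integral of |f_k| over Q on the unit ball of X
    ([cube_indicators_of_T_bound]).

    For the weak-type estimate, fix u and let E be the set where u belongs to
    M F.  It is Lebesgue measurable because every union of cubes is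
    ([measurable_bigcup_cube]).  For each e > 0, E is covered by cubes over which
    some selection of F has an average within e of u.  Every cube lies in a cell
    of one of 2^d grids, of volume at most 12^d times that of the cube
    ([cube_in_grid_cube]), and over this cell some selection averages to within
    12^-d e of 12^-d u.  Cells of one grid are nested or disjoint, so finitely
    many of them have a disjoint subfamily with the same union.  Gluing the
    selections on it gives one selection f of F for which T f is within 12^-d e
    of 12^-d u on that union.  The error matters in the norm of X only through
    its coordinates, so after restriction to a fixed cube B it has norm at most
    12^-d e times the sum of the norms of the 1_B e_k, and it disappears as e
    tends to 0.  Summing over the grids, the norm of 1_(E and B) u is at most
    24^d times the bound for the averaging operators times the norm of F
    ([M_op_level_bound]).  Finite families are replaced by countable ones, and B
    by the whole space, through the Fatou property, which holds in X because
    X'' = X ([fatou_property]).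

    Under the cube-sum hypothesis, T f is paired with g in X': Hoelder's
    inequality on each cube of the family and the bound for single cubes give a
    sum to which the hypothesis applies, and X'' = X turns this into a bound for
    T ([T_bound_of_cube_sum]).  All comparisons then follow by chaining. *)

(** * Translation invariance of Lebesgue measure *)

(** The pushforward of the product measure agrees with it on rectangles, which
    determine a product of sigma-finite measures. *)
Lemma product_measure_preserving d1 d2 (T1 : measurableType d1)
    (T2 : measurableType d2) (R : realType)
    (m1 : {sigma_finite_measure set T1 -> \bar R})
    (m2 : {sigma_finite_measure set T2 -> \bar R})
    (s1 : T1 -> T1) (s2 : T2 -> T2) :
  measurable_fun setT s1 -> measurable_fun setT s2 ->
  (forall A, measurable A -> m1 (s1 @^-1` A) = m1 A) ->
  (forall A, measurable A -> m2 (s2 @^-1` A) = m2 A) ->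
  forall A, measurable A ->
    (m1 \x m2)%E ((fun p => (s1 p.1, s2 p.2)) @^-1` A) = (m1 \x m2)%E A.
Proof.
move=> ms1 ms2 e1 e2 A mA; set s := fun p => _.
have ms : measurable_fun setT s.
  by apply/measurable_fun_pairP; split;
    [exact: (measurableT_comp ms1) | exact: (measurableT_comp ms2)].
pose m := measure_function_pushforward__canonical__measure_function_Measure
  (m1 \x m2)%E ms.
rewrite -[LHS]/(m A); apply/esym/product_measure_unique => // B C mB mC.
rewrite /m /= /pushforward.
rewrite (_ : s @^-1` (B `*` C) = (s1 @^-1` B) `*` (s2 @^-1` C)) //.
rewrite product_measure1E//.
- by congr (_ * _)%E; [exact: e1 | exact: e2].
- by rewrite -[X in measurable X]setTI; exact: ms1.
- by rewrite -[X in measurable X]setTI; exact: ms2.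
Qed.

Section translation.
Context (R : realType).

Definition tshift d (v x : d.-tuple R) : d.-tuple R :=
  [tuple tnth x i + tnth v i | i < d].

Lemma tnth_tshift d (v x : d.-tuple R) i :
  tnth (tshift v x) i = tnth x i + tnth v i.
Proof. by rewrite tnth_mktuple. Qed.

Lemma measurable_tshift d (v : d.-tuple R) :
  measurable_fun [set: d.-tuple (measurableTypeR R)]
    (tshift v : _ -> d.-tuple (measurableTypeR R)).
Proof.
apply/measurable_fun_tnthP => i.
rewrite (_ : _ \o _ = fun x : d.-tuple (measurableTypeR R) => tnth x i + tnth v i).
  by apply: measurable_funD => //; exact: measurable_tnth.
by apply/funext => x /=; rewrite tnth_tshift.
Qed.

Lemma lebesgue_measure_shift (a : R) (A : set (measurableTypeR R)) :
  measurable A ->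
  lebesgue_measure ((fun x : measurableTypeR R => x + a) @^-1` A) =
  lebesgue_measure A.
Proof.
have mf : measurable_fun [set: measurableTypeR R]
    (fun x : measurableTypeR R => (x + a : measurableTypeR R)).
  by apply: measurable_funD.
pose m := measure_function_pushforward__canonical__measure_function_Measure
  (@lebesgue_measure R) mf.
move=> mA; rewrite -[LHS]/(m A); apply/esym/lebesgue_measure_unique => //.
move=> X [[p q] _ <-] /=.
rewrite /pushforward (_ : _ @^-1` _ = `]p - a, q - a]%classic).
  rewrite !lebesgue_measure_itv /= !lte_fin ltrD2r.
  by case: ifPn => // _; rewrite -!EFinB; congr (_%:E); ring.
by apply/seteqP; split=> x /=; rewrite !in_itv /=; lra.
Qed.

Lemma tshift_tcons d (v : d.+1.-tuple R) (p : R * d.-tuple R) :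
  tshift v (tcons p) =
  tcons (p.1 + thead v, tshift [tuple of behead v] p.2) :> d.+1.-tuple R.
Proof.
case: p => x t; apply: eq_from_tnth => i; rewrite tnth_tshift /tcons.
by case: (unliftP ord0 i) => [j|] ->;
  rewrite ?tnthS ?tnth0 ?tnth_tshift ?tnth_behead; congr (_ + tnth v _);
  apply/val_inj; rewrite //= inordK// ltnS ltn_ord.
Qed.

Lemma preimage_congr T U (f g : T -> U) (A : set U) (h : T -> T) :
  (forall x, f x = g (h x)) -> f @^-1` A = h @^-1` (g @^-1` A).
Proof. by move=> e; rewrite /preimage; apply/funext => x; rewrite /= e. Qed.

Lemma borel_lebesgue_tshift d (v : d.-tuple R)
    (A : set (d.-tuple (measurableTypeR R))) : measurable A ->
  borel_lebesgue R d (tshift v @^-1` A) = borel_lebesgue R d A.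
Proof.
elim: d => [|d IH] in v A *.
  move=> _; congr (borel_lebesgue R 0 _).
  by apply/seteqP; split => x /=; rewrite (tuple0 x) (tuple0 (tshift _ _)).
move=> mA; rewrite /= /borel_lebesgue_succ /pushforward.
set a := thead v; set w := [tuple of behead v].
rewrite (_ : @tcons R d @^-1` (tshift v @^-1` A) =
    (fun p => ((p.1 + a : measurableTypeR R), tshift w p.2)) @^-1` (@tcons R d @^-1` A)).
  apply: (@product_measure_preserving _ _ _ _ R (@lebesgue_measure R)
    (borel_lebesgue R d) (fun x : measurableTypeR R => x + a) (tshift w)).
  - by apply: measurable_funD.
  - exact: measurable_tshift.
  - exact: lebesgue_measure_shift.
  - exact: IH.
  - by rewrite -[X in measurable X]setTI; apply: measurable_tcons.
exact: (@preimage_congr _ _ (fun p => tshift v (@tcons R d p)) _ A _ (tshift_tcons v)).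
Qed.

End translation.

(** * Cubes and their volumes *)

Section cubes.
Context (R : realType) (d : nat).
Local Notation Bd := (d.-tuple (measurableTypeR R)).

Definition box d (a : d.-tuple R) (l : R) (b c : 'I_d -> bool) : set (d.-tuple R) :=
  [set x | forall i, tnth x i \in
           Interval (BSide (b i) (tnth a i)) (BSide (c i) (tnth a i + l))].

Lemma measurable_coordinatewise (D : 'I_d -> set R) :
  (forall i, measurable (D i : set (measurableTypeR R))) ->
  measurable ([set x | forall i, D i (tnth x i)] : set Bd).
Proof.
move=> mD.
rewrite (_ : [set x | _] = \bigcap_(i in [set: 'I_d]) ((fun x : Bd => tnth x i) @^-1` D i)).
  apply: fin_bigcap_measurable => // i _.
  rewrite -[X in measurable X]setTI; exact: measurable_tnth.
by apply/seteqP; split=> x /= h i; [move=> _|]; apply: h.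
Qed.

Lemma measurable_box a l b c : measurable (box a l b c : set Bd).
Proof.
apply: (measurable_coordinatewise (D := fun i =>
  [set` Interval (BSide (b i) (tnth a i)) (BSide (c i) (tnth a i + l))])).
by move=> i; apply: measurable_itv.
Qed.

End cubes.

Lemma borel_lebesgue_box (R : realType) d (a : d.-tuple R) l b c : 0 < l ->
  borel_lebesgue R d (box a l b c) = (l ^+ d)%:E.
Proof.
move=> l0; elim: d => [|d IH] in a b c *.
  rewrite (_ : box _ _ _ _ = setT) ?expr0.
    by rewrite /= /borel_lebesgue_zero diracT.
  by apply/seteqP; split => // x _ [].
rewrite /= /borel_lebesgue_succ /pushforward.
pose I := Interval (BSide (b ord0) (tnth a ord0)) (BSide (c ord0) (tnth a ord0 + l)).
pose a' := [tuple of behead a].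
pose b' (i : 'I_d) := b (lift ord0 i).
pose c' (i : 'I_d) := c (lift ord0 i).
rewrite (_ : _ @^-1` _ = [set` I] `*` box a' l b' c').
  apply: (etrans (@product_measure1E _ _ _ _ R (@lebesgue_measure R)
    (borel_lebesgue R d) _ _ (measurable_itv I) (measurable_box a' l b' c'))).
  rewrite exprS EFinM; congr (_ * _)%E; last exact: IH.
  apply: (etrans (lebesgue_measure_itv I)).
  by rewrite /I /= lte_fin ltrDl l0 -EFinB addrAC subrr add0r.
have an i : tnth a' i = tnth a (lift ord0 i).
  by rewrite tnth_behead; congr tnth; apply/val_inj; rewrite /= inordK// ltnS.
apply/seteqP; split=> -[x t] /=.
  move=> h; split=> /=; first by have := h ord0; rewrite /tcons tnth0.
  by move=> i; have := h (lift ord0 i); rewrite /tcons tnthS an.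
case=> /= h0 h i; case: (unliftP ord0 i) => [j|] ->; rewrite ?tnth0 ?tnthS//.
by have := h j; rewrite an.
Qed.

Section Lebesgue.
Context (R : realType) (d : nat).
Local Notation Bd := (d.-tuple (measurableTypeR R)).
Local Notation Rd := (Rd R d).
Local Notation mu := (Leb R d).

Lemma measurable_borel_Rd (A : set (d.-tuple R)) :
  measurable (A : set Bd) -> measurable (A : set Rd).
Proof. exact: caratheodory_measurable_mu_ext. Qed.

Lemma Leb_borel (A : set (d.-tuple R)) :
  measurable (A : set Bd) -> mu A = borel_lebesgue R d A.
Proof. exact: measurable_mu_extE. Qed.

Lemma negligible_measurable_Rd (A : set Rd) : mu.-negligible A -> measurable A.
Proof. exact: measure_is_complete_caratheodory. Qed.

Lemma cubeP (Q : set Rd) : cube Q -> exists a l b c, 0 < l /\ Q = box a l b c.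
Proof. by case=> a [l] [b] [c] [l0 ->]; exists a, l, b, c. Qed.

Lemma measurable_cube (Q : set Rd) : cube Q -> measurable Q.
Proof.
move=> /cubeP[a [l [b [c [_ ->]]]]]; apply: measurable_borel_Rd.
exact: measurable_box.
Qed.

Lemma Leb_box a l b c : 0 < l -> mu (box a l b c) = (l ^+ d)%:E.
Proof.
move=> l0; apply: (etrans (Leb_borel (measurable_box a l b c))).
exact: borel_lebesgue_box.
Qed.

Lemma Leb_cube_fin (Q : set Rd) : cube Q -> mu Q \is a fin_num.
Proof. by move=> /cubeP[a [l [b [c [l0 ->]]]]]; rewrite Leb_box. Qed.

Lemma Leb_cube_gt0 (Q : set Rd) : cube Q -> (0 < mu Q)%E.
Proof. by move=> /cubeP[a [l [b [c [l0 ->]]]]]; rewrite Leb_box// lte_fin exprn_gt0. Qed.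

Definition rational_box (q : d.-tuple rat * rat) : set (d.-tuple R) :=
  [set x | forall i, `|tnth x i - ratr (tnth q.1 i)| < ratr q.2].

Lemma measurable_rational_box q : measurable (rational_box q : set Bd).
Proof.
apply: (measurable_coordinatewise (D := fun i =>
  [set y | `|y - ratr (tnth q.1 i)| < ratr q.2])) => i.
rewrite (_ : [set y | _] = [set` `](ratr (tnth q.1 i) - ratr q.2 : R),
                                   (ratr (tnth q.1 i) + ratr q.2 : R)[]).
  exact: measurable_itv.
apply/seteqP; split=> x /=; rewrite in_itv /= ltr_norml => /andP[? ?];
  by apply/andP; split; lra.
Qed.

(** Rational boxes form a countable base of the topology of R^d. *)
Lemma rational_box_neighborhood (x : d.-tuple R) (e : R) : 0 < e ->
  exists q, rational_box q x /\
    (forall y, rational_box q y -> forall i, `|tnth y i - tnth x i| < e).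
Proof.
move=> e0; have e2 : 0 < e / 2 by rewrite divr_gt0.
have [p] := rat_in_itvoo e2; rewrite in_itv /= => /andP[p0 pe].
have ex i : exists q : rat, `|tnth x i - ratr q| < ratr p.
  have : tnth x i - ratr p < tnth x i + ratr p by lra.
  move=> /rat_in_itvoo[q]; rewrite in_itv /= => /andP[h1 h2].
  by exists q; rewrite ltr_norml; apply/andP; split; lra.
exists ([tuple projT1 (cid (ex i)) | i < d], p); split.
  by move=> i /=; rewrite tnth_mktuple; exact: (projT2 (cid (ex i))).
move=> y hy i; have := hy i; rewrite /= tnth_mktuple.
have := projT2 (cid (ex i)); set q := projT1 _.
rewrite !ltr_norml => /andP[? ?] /andP[? ?]; apply/andP; split; lra.
Qed.

Lemma measurable_bigcup_rational_box (P : set (d.-tuple rat * rat)) :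
  measurable (\bigcup_(q in P) rational_box q : set Bd).
Proof.
rewrite bigcup_mkcond; apply: countable_bigcupT_measurable.
  exact: countableP.
by move=> q; case: ifPn => _; [exact: measurable_rational_box | exact: measurable0].
Qed.

End Lebesgue.
Arguments rational_box R {d} q.

(** * Unions of cubes are Lebesgue measurable *)

(** Any number m of the sets N k gives m c <= mu B. *)
Lemma measure_eq0_of_disjoint_copies d (T : measurableType d) (R : realType)
    (mu : {measure set T -> \bar R}) (N : nat -> set T) (B : set T) (c : \bar R) :
  (forall k, measurable (N k)) -> (forall k, mu (N k) = c) ->
  trivIset setT N -> measurable B -> (forall k, N k `<=` B) ->
  (mu B < +oo)%E -> c = 0%E.
Proof.
move=> mN muN tN mB NB Boo.
have c0 : (0 <= c)%E by rewrite -(muN 0).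
have cB (n : nat) : (n%:R%:E * c <= mu B)%E.
  have UB : \bigcup_k N k `<=` B by move=> x [k _]; exact: NB.
  have mU : measurable (\bigcup_k N k) by exact: bigcupT_measurable.
  apply: (@le_trans _ _ (mu (\bigcup_k N k))); last by apply: le_measure; rewrite ?inE.
  rewrite measure_bigcup//.
  apply: le_trans (nneseries_lim_ge n _) => //.
  rewrite (eq_big xpredT (fun=> c)); [|by move=> i; rewrite in_setT|by move=> i _].
  elim: n => [|n IH]; first by rewrite big_geq// mul0e.
  rewrite big_nat_recr//= -natr1 EFinD ge0_muleDl ?lee_fin// mul1e.
  exact: leeD.
have := c0; rewrite le_eqVlt => /orP[/eqP<-//|cpos].
have cfin : c \is a fin_num.
  rewrite ge0_fin_numE//; apply: le_lt_trans Boo.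
  by have := cB 1; rewrite mul1e.
have Bfin : mu B \is a fin_num by rewrite ge0_fin_numE.
have fc : 0 < fine c by apply: fine_gt0; rewrite cpos ltey_eq cfin.
have [k hk] : exists k : nat, fine (mu B) / fine c < k%:R.
  exists (Num.bound (fine (mu B) / fine c)).
  by apply: le_lt_trans (archi_boundP _); rewrite ?divr_ge0 ?fine_ge0// ler_norm.
exfalso; have := cB k.
rewrite -(fineK cfin) -(fineK Bfin) -EFinM lee_fin leNgt => /negP; apply.
by rewrite -ltr_pdivrMr.
Qed.

Section union_of_cubes.
Context (R : realType) (d : nat).
Local Notation Bd := (d.-tuple (measurableTypeR R)).
Local Notation Rd := (Rd R d).
Local Notation mu := (Leb R d).

(** The signs s choose one of the 2^d diagonal directions. *)
Definition diagonal (s : {ffun 'I_d -> bool}) (t : R) : d.-tuple R :=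
  [tuple (if s i then t else - t) | i < d].

Lemma tshift_diagonal (s : {ffun 'I_d -> bool}) (t u : R) (x : d.-tuple R) :
  tshift (diagonal s t) (tshift (diagonal s u) x) = tshift (diagonal s (t + u)) x.
Proof.
apply: eq_from_tnth => i; rewrite !tnth_tshift /diagonal !tnth_mktuple.
by case: (s i); lra.
Qed.

Lemma preimage_tshift_measurable (v : d.-tuple R) (A : set (d.-tuple R)) :
  measurable (A : set Bd) -> measurable (tshift v @^-1` A : set Bd).
Proof. by move=> mA; rewrite -[X in measurable X]setTI; exact: measurable_tshift. Qed.

(** The points outside V from which V is entered at once along the diagonal
    direction k.1.1, cut down to a bounded set; rational parameters make it a
    countable intersection. *)
Definition entering (V : set (d.-tuple R)) (k : {ffun 'I_d -> bool} * nat * nat) :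
    set (d.-tuple R) :=
  [set x | ~ V x] `&` [set x | forall i, `|tnth x i| <= k.2%:R] `&`
  \bigcap_(q in [set q : rat | 0 < q /\ (ratr q : R) < k.1.2.+1%:R^-1])
     tshift (diagonal k.1.1 (ratr q)) @^-1` V.

Lemma measurable_entering V k :
  measurable (V : set Bd) -> measurable (entering V k : set Bd).
Proof.
move=> mV; apply: measurableI; first apply: measurableI.
- exact: measurableC.
- apply: (measurable_coordinatewise (D := fun=> [set y | `|y| <= k.2%:R])) => i.
  rewrite (_ : [set y | _] = [set` `[(- k.2%:R : R), (k.2%:R : R)]]).
    exact: measurable_itv.
  by apply/seteqP; split=> x /=; rewrite in_itv /= ler_norml.
- rewrite -[X in measurable X]setCK setC_bigcap; apply: measurableC.
  rewrite bigcup_mkcond; apply: countable_bigcupT_measurable; first exact: countableP.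
  move=> q; case: ifPn => _; last exact: measurable0.
  by apply: measurableC; exact: preimage_tshift_measurable.
Qed.

(** Distinct small translates along the diagonal are disjoint: if x and y are in
    the set and y = x + t s with t > 0 small, then y is in V.  Infinitely many
    of them fit into a bounded set. *)
Lemma entering_null V k :
  measurable (V : set Bd) -> borel_lebesgue R d (entering V k) = 0%E.
Proof.
case: k => -[s j] m mV; set N := entering _ _.
have mN : measurable (N : set Bd) by exact: measurable_entering.
pose q (k : nat) : rat := (j + k).+2%:R^-1.
have q0 k : 0 < q k by rewrite invr_gt0.
have qj k : (ratr (q k) : R) < j.+1%:R^-1.
  by rewrite fmorphV /= ratr_nat ltf_pV2 ?posrE// ltr_nat ltnS leq_addr.
have qltn k l : (k < l)%N -> q l < q k.
  by move=> kl; rewrite ltf_pV2 ?posrE// ltr_nat !ltnS ltn_add2l.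
pose B := box [tuple (- m%:R - 1 : R) | i < d] (m%:R *+ 2 + 2)
   (fun=> true) (fun=> false).
apply: (@measure_eq0_of_disjoint_copies _ _ _ (borel_lebesgue R d)
  (fun k => tshift (diagonal s (- ratr (q k))) @^-1` N) B).
- by move=> k; exact: preimage_tshift_measurable.
- by move=> k; apply: borel_lebesgue_tshift.
- have disj k l z : (k < l)%N -> N (tshift (diagonal s (- ratr (q k))) z) ->
      N (tshift (diagonal s (- ratr (q l))) z) -> False.
    move=> kl [_ /(_ (q k - q l)) hV] [[nV _] _]; apply: nV.
    have := hV; rewrite /= tshift_diagonal rmorphB /=.
    rewrite (_ : ratr (q k) - ratr (q l) - ratr (q k) = - ratr (q l) :> R); last by ring.
    apply; split; first by rewrite subr_gt0 qltn.
    apply: le_lt_trans (qj k); rewrite gerBl.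
    by rewrite ler0q ltW.
  apply/trivIsetP => k l _ _ /eqP nkl; apply/seteqP; split=> // z [h1 h2].
  by case: (ltngtP k l) => [kl|lk|//]; [exact: (disj k l z) | exact: (disj l k z)].
- exact: measurable_box.
- move=> k z [[_ hz] _] i; have := hz i.
  rewrite !tnth_tshift !tnth_mktuple in_itv /= => h.
  have t1 : (ratr (q k) : R) < 1.
    by apply: lt_le_trans (qj k) _; rewrite invf_le1 ?ler1n.
  have t0 : 0 < (ratr (q k) : R) by rewrite ltr0q.
  by move: h; rewrite ler_norml; case: (s i) => /andP[h1 h2]; apply/andP; split;
    move: h1 h2 t1 t0; set t := ratr _; set M : R := m%:R; lra.
- have l0 : 0 < m%:R *+ 2 + 2 :> R by rewrite ltr_wpDl// mulrn_wge0.
  have := ltry ((m%:R *+ 2 + 2 : R) ^+ d).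
  by rewrite -(borel_lebesgue_box [tuple (- m%:R - 1 : R) | i < d]
    (fun=> true) (fun=> false) l0).
Qed.

(** Let V be the union of the rational boxes contained in U.  A point of U outside
    V lies on the boundary of a cube of the family, so the diagonal towards the
    centre of that cube leads at once into its interior, hence into V.  Therefore
    the difference of U and V is covered by countably many null sets, and
    Lebesgue measure is complete. *)
Lemma measurable_bigcup_cube (F : set (set Rd)) :
  F `<=` @cube R d -> measurable (\bigcup_(Q in F) Q).
Proof.
move=> Fc; set U := \bigcup_(Q in F) Q.
pose P := [set q : d.-tuple rat * rat | rational_box R q `<=` U].
pose V : set (d.-tuple R) := \bigcup_(q in P) rational_box R q.
have mV : measurable (V : set Bd) by exact: measurable_bigcup_rational_box.
have VU : V `<=` U by move=> x [q]; apply.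
rewrite (_ : U = V `|` (U `\` V)); last first.
  by rewrite setDE setUIr setUv setIT; apply/esym/setUidPr.
apply: measurableU; first exact: measurable_borel_Rd.
apply: negligible_measurable_Rd.
pose E k : set Rd := if unpickle k is Some k' then entering V k' else set0.
have negE k : mu.-negligible (E k).
  rewrite /E; case: (unpickle k) => [k'|]; last exact: negligible_set0.
  have mE := measurable_entering k' mV.
  exists (entering V k'); split => //; first exact: measurable_borel_Rd.
  by apply: (etrans (Leb_borel mE)); exact: entering_null.
apply: (negligibleS _ (negligible_bigcup negE)).
move=> x [[Q FQ Qx] nVx].
have [a [l [b [c [l0 QE]]]]] := cubeP (Fc _ FQ).
(* the diagonal direction that points from x towards the centre of Q *)
pose s := [ffun i : 'I_d => tnth x i < tnth a i + l / 2].
pose j := Num.bound (2 / l).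
have jl : (j.+1%:R^-1 : R) < l / 2.
  rewrite -[X in _ < X]invf_div ltf_pV2 ?posrE ?divr_gt0//.
  apply: (@lt_le_trans _ _ j%:R); last by rewrite ler_nat.
  by apply: le_lt_trans (archi_boundP _); rewrite ?ler_norm// divr_ge0// ltW.
pose m := \max_(i < d) Num.bound `|tnth x i|.
exists (pickle (s, j, m)) => //; rewrite /E pickleK; split; first split => //.
  move=> i; apply: (@le_trans _ _ (Num.bound `|tnth x i|)%:R).
    by apply/ltW/archi_boundP.
  by rewrite ler_nat /m; exact: leq_bigmax.
move=> q [q0 qj].
have t0 : 0 < (ratr q : R) by rewrite ltr0q.
have t1 : (ratr q : R) < l / 2 by apply: lt_trans jl.
pose y := tshift (diagonal s (ratr q)) x; rewrite /= -/y.
(* a lower bound for the distance from y to the faces of Q *)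
pose e := Num.min (ratr q : R) (l / 2 - ratr q).
have e0 : 0 < e by rewrite lt_min t0 subr_gt0.
have eq1 : e <= ratr q by rewrite ge_min lexx.
have eq2 : e <= l / 2 - ratr q by rewrite ge_min lexx orbT.
have [p [py hp]] := rational_box_neighborhood y e0.
exists p => // z /hp hz; exists Q => //; rewrite QE => i.
have := hz i; rewrite tnth_tshift tnth_mktuple ffunE => hi.
have {Qx}: box a l b c x by rewrite -QE.
move=> /(_ i) xi.
have {xi}[x1 x2] : tnth a i <= tnth x i /\ tnth x i <= tnth a i + l.
  move: xi; rewrite in_itv /=.
  by case: (b i); case: (c i) => /= /andP[h1 h2]; split; rewrite ?(ltW h1) ?(ltW h2).
have [z1 z2] : tnth a i < tnth z i /\ tnth z i < tnth a i + l.
  move: hi; rewrite ltr_norml => /andP[h1 h2].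
  clearbody e; move: h1 h2; case: (ltP (tnth x i) (tnth a i + l / 2)) => xl h1 h2; split; lra.
by rewrite in_itv /=; case: (b i); case: (c i) => /=; rewrite ?z1 ?z2 ?(ltW z1) ?(ltW z2).
Qed.

End union_of_cubes.

(** * Scalars, real or complex *)

Section scalars.
Context (R : realType) (F : scalars).
Local Notation K := (scal R F).
Implicit Types (z w : K) (a b : R).

(** The embedding of R into the scalars. *)
Definition sr a : K := smk F a 0.

Lemma smkE z : smk F (sre z) (sim z) = z.
Proof. by case: F z => //= -[]. Qed.

Lemma sre_smk a b : sre (smk F a b) = a.
Proof. by case: F. Qed.

Lemma sreD z w : sre (z + w) = sre z + sre w.
Proof. by case: F z w => //= -[a b] [c e]. Qed.

Lemma simD z w : sim (z + w) = sim z + sim w.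
Proof. by case: F z w => [|[a b] [c e]] //=; rewrite addr0. Qed.

Lemma sre0 : sre (0 : K) = 0. Proof. by case: F. Qed.
Lemma sim0 : sim (0 : K) = 0. Proof. by case: F. Qed.

Lemma sreN z : sre (- z) = - sre z.
Proof. by case: F z => //= -[]. Qed.

Lemma simN z : sim (- z) = - sim z.
Proof. by case: F z => [|[]] //=; rewrite oppr0. Qed.

Lemma sreB z w : sre (z - w) = sre z - sre w.
Proof. by rewrite sreD sreN. Qed.

Lemma simB z w : sim (z - w) = sim z - sim w.
Proof. by rewrite simD simN. Qed.

Lemma sreM z w : sre (z * w) = sre z * sre w - sim z * sim w.
Proof. by case: F z w => [z w|[a b] [c e]] //=; rewrite mulr0 subr0. Qed.

Lemma simM z w : sim (z * w) = sre z * sim w + sim z * sre w.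
Proof. by case: F z w => [z w|[a b] [c e]] //=; rewrite mulr0 mul0r addr0. Qed.

Lemma scal_eq z w : sre z = sre w -> sim z = sim w -> z = w.
Proof. by move=> h1 h2; rewrite -(smkE z) h1 h2 smkE. Qed.

Lemma sre_sr a : sre (sr a) = a. Proof. exact: sre_smk. Qed.
Lemma sim_sr a : sim (sr a) = 0. Proof. by rewrite /sr; case: F. Qed.

Lemma sr0 : sr 0 = 0. Proof. by apply: scal_eq; rewrite ?sre_sr ?sim_sr ?sre0 ?sim0. Qed.
Lemma sre1 : sre (1 : K) = 1. Proof. by case: F. Qed.
Lemma sim1 : sim (1 : K) = 0. Proof. by case: F. Qed.
Lemma sr1 : sr 1 = 1.
Proof. by apply: scal_eq; rewrite ?sre_sr ?sim_sr ?sre1 ?sim1. Qed.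

Lemma srD a b : sr (a + b) = sr a + sr b.
Proof. by apply: scal_eq; rewrite ?sreD ?simD ?sre_sr ?sim_sr ?addr0. Qed.

Lemma srN a : sr (- a) = - sr a.
Proof. by apply: scal_eq; rewrite ?sreN ?simN ?sre_sr ?sim_sr ?oppr0. Qed.

Lemma srM a b : sr (a * b) = sr a * sr b.
Proof.
by apply: scal_eq; rewrite ?sreM ?simM ?sre_sr ?sim_sr ?mulr0 ?mul0r ?subr0 ?addr0.
Qed.

Lemma normE z : `|z| = sr (sabs z).
Proof.
rewrite /sabs /sr; case: F z => //= z.
Qed.

Lemma sr_le a b : (sr a <= sr b) = (a <= b).
Proof. by rewrite /sr; case: F => //=; rewrite lecE /= eqxx. Qed.

Lemma sr_lt a b : (sr a < sr b) = (a < b).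
Proof. by rewrite /sr; case: F => //=; rewrite ltcE /= eqxx. Qed.

Lemma scal_gt0 z : 0 < z -> z = sr (sre z) /\ 0 < sre z.
Proof.
rewrite /sr; case: F z => //= -[a b]; rewrite ltcE /= => /andP[/eqP -> ?]; by split.
Qed.

Lemma sabsE z : sabs z = Num.sqrt (sre z ^+ 2 + sim z ^+ 2).
Proof.
by rewrite /sabs; case: F z => [z|[a b]] //=; rewrite expr0n addr0 sqrtr_sqr.
Qed.

Lemma sr_inj a b : sr a = sr b -> a = b.
Proof. by move=> /(congr1 (@sre R F)); rewrite !sre_sr. Qed.

Lemma sabs_ge0 z : 0 <= sabs z. Proof. by rewrite sabsE sqrtr_ge0. Qed.

Lemma sabsM z w : sabs (z * w) = sabs z * sabs w.
Proof. by apply: sr_inj; rewrite srM -!normE normrM. Qed.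

Lemma sabsD z w : sabs (z + w) <= sabs z + sabs w.
Proof. by rewrite -sr_le srD -!normE ler_normD. Qed.

Lemma sabsN z : sabs (- z) = sabs z.
Proof. by apply: sr_inj; rewrite -!normE normrN. Qed.

Lemma sabs_eq0 z : sabs z = 0 -> z = 0.
Proof. by move=> h; apply/eqP; rewrite -normr_eq0 normE h sr0. Qed.

Lemma sabs0 : sabs (0 : K) = 0.
Proof. by apply: sr_inj; rewrite -normE normr0 sr0. Qed.

Lemma sabs1 : sabs (1 : K) = 1.
Proof. by apply: sr_inj; rewrite -normE normr1 sr1. Qed.

Lemma sabs_sr a : sabs (sr a) = `|a|.
Proof. by rewrite sabsE sre_sr sim_sr expr0n addr0 sqrtr_sqr. Qed.

Lemma sabs_le1 z : (`|z| <= 1) = (sabs z <= 1).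
Proof. by rewrite normE -sr1 sr_le. Qed.

Lemma sconj_re z : sre (sconj z) = sre z. Proof. exact: sre_smk. Qed.

Lemma sconj_im z : sim (sconj z) = - sim z.
Proof. by rewrite /sconj; case: F z => //= z; rewrite oppr0. Qed.

Lemma sabs_conj z : sabs (sconj z) = sabs z.
Proof. by rewrite !sabsE sconj_re sconj_im sqrrN. Qed.

Lemma sabs_sqr z : sabs z ^+ 2 = sre z ^+ 2 + sim z ^+ 2.
Proof. by rewrite sabsE sqr_sqrtr// addr_ge0// sqr_ge0. Qed.

Lemma mul_sconj z : z * sconj z = sr (sabs z ^+ 2).
Proof.
apply: scal_eq; rewrite ?sreM ?simM ?sre_sr ?sim_sr sconj_re sconj_im ?sabs_sqr; ring.
Qed.

Lemma sre_sabs z : `|sre z| <= sabs z.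
Proof. by rewrite sabsE -sqrtr_sqr ler_sqrt ?addr_ge0 ?sqr_ge0// lerDl sqr_ge0. Qed.

Lemma sim_sabs z : `|sim z| <= sabs z.
Proof. by rewrite sabsE -sqrtr_sqr ler_sqrt ?addr_ge0 ?sqr_ge0// lerDr sqr_ge0. Qed.

Lemma sabs_reim z : sabs z <= `|sre z| + `|sim z|.
Proof.
rewrite -(@ler_pXn2r _ 2) ?nnegrE ?sabs_ge0 ?addr_ge0// sabs_sqr sqrrD.
by rewrite !real_normK ?num_real// lerD2r lerDl mulrn_wge0// mulr_ge0.
Qed.

Lemma sre_srM a z : sre (sr a * z) = a * sre z.
Proof. by rewrite sreM sre_sr sim_sr mul0r subr0. Qed.

Lemma sim_srM a z : sim (sr a * z) = a * sim z.
Proof. by rewrite simM sre_sr sim_sr mul0r addr0. Qed.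

End scalars.
Arguments sr {R F} a.

(** * Measurability of vector-valued functions *)

Section rows.
Context (R : realType) (F : scalars) (n : nat).
Local Notation Fn := 'rV[scal R F]_n.
Implicit Types (u v : Fn) (U : set Fn).

(** The sup-norm balls of the space of row vectors, with a real radius. *)
Definition row_close (e : R) u v := forall k, sabs (v 0 k - u 0 k) < e.

Lemma nbhs_rowP u U : nbhs u U <-> exists2 e : R, 0 < e & row_close e u `<=` U.
Proof.
split.
  move=> /nbhs_ballP[e e0 h].
  have [e1 e2] := scal_gt0 e0.
  exists (sre e) => // v hv; apply: h; split=> // i j; rewrite ord1.
  by rewrite -ball_normE /= distrC normE [ltRHS]e1 sr_lt.
move=> [e e0 h]; apply/nbhs_ballP; exists (sr e) => /=.
  by rewrite -[X in X < _](@sr0 R F) sr_lt.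
move=> v [_ hv]; apply: h => k.
by have := hv 0 k; rewrite -ball_normE /= distrC normE sr_lt.
Qed.
End rows.

Section cells.
Context (R : realType) (F : scalars) (n : nat).
Local Notation Fn := 'rV[scal R F]_n.
Implicit Types (u v : Fn) (U : set Fn).

Lemma rat_near (a e : R) : 0 < e -> exists q : rat, `|a - ratr q| < e.
Proof.
move=> e0; have : a - e < a + e by lra.
move=> /rat_in_itvoo[q]; rewrite in_itv /= => /andP[h1 h2].
by exists q; rewrite ltr_norml; apply/andP; split; lra.
Qed.

Definition rational_cell (c : {ffun 'I_n -> rat * rat} * rat) : set Fn :=
  [set u | forall k, `|sre (u 0 k) - ratr (c.1 k).1| < ratr c.2 /\
                     `|sim (u 0 k) - ratr (c.1 k).2| < ratr c.2].

(** Together with the countability of the index type, this reduces the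
    measurability of f to that of its coordinates. *)
Lemma open_bigcup_rational_cell U : open U ->
  U = \bigcup_(c in [set c | rational_cell c `<=` U]) rational_cell c.
Proof.
move=> oU; apply/seteqP; split=> [u Uu|u [c cU]]; last exact: cU.
have /nbhs_rowP[e e0 eU] : nbhs u U by exact: open_nbhs_nbhs.
have [p] : exists p : rat, (ratr p : R) \in `]0, e / 4[.
  by apply: rat_in_itvoo; rewrite divr_gt0.
rewrite in_itv /= => /andP[p0 pe].
have ex (a : R) : exists q : rat, `|a - ratr q| < ratr p by exact: rat_near.
pose q a := projT1 (cid (ex a)).
have qP a : `|a - ratr (q a)| < ratr p := projT2 (cid (ex a)).
exists ([ffun k => (q (sre (u 0 k)), q (sim (u 0 k)))], p).
  move=> v hv; apply: eU => k; apply: le_lt_trans (sabs_reim _) _.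
  have := hv k; rewrite /= ffunE /= sreB simB.
  have := qP (sre (u 0 k)); have := qP (sim (u 0 k)).
  move: (ratr (q _)) => s; move: (ratr (q _)) => t.
  rewrite (distrC _ s) (distrC _ t) => h1 h2 [h3 h4].
  rewrite -[sre (v 0 k) - _](subrKA t) -[sim (v 0 k) - _](subrKA s).
  have := ler_normD (sre (v 0 k) - t) (t - sre (u 0 k)).
  have := ler_normD (sim (v 0 k) - s) (s - sim (u 0 k)).
  lra.
by move=> k; rewrite /= ffunE.
Qed.

End cells.

Section measurability.
Context (R : realType) (F : scalars) (d n : nat).
Local Notation K := (scal R F).
Local Notation Fn := 'rV[scal R F]_n.
Local Notation Rd := (Rd R d).
Implicit Types (f g : Rd -> Fn) (h : Rd -> K).

(** Measurability is stated through real and imaginary parts, so that real and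
    complex scalars are treated at once. *)
Definition measurable_scal h :=
  measurable_fun [set: Rd] (fun x => sre (h x)) /\
  measurable_fun [set: Rd] (fun x => sim (h x)).

Lemma L0P f : L0 f <-> forall k, measurable_scal (fun x => f x 0 k).
Proof.
split.
  move=> mf k.
  have ofc (p : K -> R) : (forall z w, p (z - w) = p z - p w) ->
      (forall z, `|p z| <= sabs z) -> measurable_fun [set: Rd] (fun x => p (f x 0 k)).
    move=> pB p1; apply: (measurability _ (RGenOInfty.measurableE R)) => //.
    move=> /= _ [_ [a ->] <-]; rewrite setTI.
    apply: (mf [set u : Fn | p (u 0 k) \in `]a, +oo[%R]).
    rewrite openE => u; rewrite /= in_itv /= andbT => au.
    apply/nbhs_rowP; exists (p (u 0 k) - a); first by rewrite subr_gt0.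
    move=> v /(_ k); rewrite /= in_itv /= andbT => hk.
    have := p1 (v 0 k - u 0 k); rewrite pB ler_norml => /andP[+ _]; lra.
  split; apply: ofc; [exact: sreB | exact: sre_sabs | exact: simB | exact: sim_sabs].
move=> mf U /open_bigcup_rational_cell ->; rewrite preimage_bigcup bigcup_mkcond.
apply: countable_bigcupT_measurable; first exact: countableP.
move=> c; case: ifPn => _; last exact: measurable0.
have mball (p : Rd -> R) (a b : R) : measurable_fun setT p ->
    measurable [set x | `|p x - a| < b].
  move=> mp; rewrite (_ : [set x | _] = p @^-1` [set` `](a - b), (a + b)[]).
    by rewrite -[X in measurable X]setTI; apply: mp => //; exact: measurable_itv.
  apply/seteqP; split=> x /=; rewrite in_itv /= ltr_norml => /andP[? ?];
    by apply/andP; split; lra.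
rewrite (_ : f @^-1` _ = \bigcap_(k in [set: 'I_n])
   ([set x | `|sre (f x 0 k) - ratr (c.1 k).1| < ratr c.2] `&`
    [set x | `|sim (f x 0 k) - ratr (c.1 k).2| < ratr c.2])).
  apply: fin_bigcap_measurable => // k _; have [m1 m2] := mf k.
  by apply: measurableI; exact: mball.
by apply/seteqP; split=> x /= H k; [move=> _|]; exact: H.
Qed.

Lemma measurable_scal_cst (a : K) : measurable_scal (cst a).
Proof.
by split; [exact: (measurable_cst (sre a)) | exact: (measurable_cst (sim a))].
Qed.

Lemma measurable_scalD h1 h2 : measurable_scal h1 -> measurable_scal h2 ->
  measurable_scal (fun x => h1 x + h2 x).
Proof.
move=> [a1 b1] [a2 b2]; split.
- by under eq_fun do rewrite sreD; exact: measurable_funD.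
- by under eq_fun do rewrite simD; exact: measurable_funD.
Qed.

Lemma measurable_scalM h1 h2 : measurable_scal h1 -> measurable_scal h2 ->
  measurable_scal (fun x => h1 x * h2 x).
Proof.
move=> [a1 b1] [a2 b2]; split.
- by under eq_fun do rewrite sreM; apply: measurable_funB; exact: measurable_funM.
- by under eq_fun do rewrite simM; apply: measurable_funD; exact: measurable_funM.
Qed.

Lemma measurable_scal_conj h : measurable_scal h -> measurable_scal (fun x => sconj (h x)).
Proof.
move=> [a b]; split.
- by under eq_fun do rewrite sconj_re.
- by under eq_fun do rewrite sconj_im; exact: measurable_funN.
Qed.

Lemma measurable_scal_sum (I : Type) (s : seq I) (h : I -> Rd -> K) :
  (forall i, measurable_scal (h i)) -> measurable_scal (fun x => \sum_(i <- s) h i x).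
Proof.
move=> mh; elim: s => [|i s IH].
  rewrite (_ : (fun _ => _) = cst 0); first exact: measurable_scal_cst.
  by apply/funext => x; rewrite big_nil.
by under eq_fun do rewrite big_cons; exact: measurable_scalD.
Qed.

Lemma measurable_scal_sr (r : Rd -> R) :
  measurable_fun setT r -> measurable_scal (fun x => sr (r x)).
Proof.
move=> mr; split; first by under eq_fun do rewrite sre_sr.
by under eq_fun do rewrite sim_sr; exact: measurable_cst.
Qed.

Lemma measurable_scal_indic (G : set Rd) :
  measurable G -> measurable_scal (fun x => \1_G x : K).
Proof.
move=> mG; rewrite (_ : (fun _ => _) = fun x => sr (\1_G x)).
  by apply: measurable_scal_sr; exact: measurable_indic.
by apply/funext => x; rewrite !indicE; case: (x \in G); rewrite ?sr1 ?sr0.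
Qed.

Lemma measurable_sabs h : measurable_scal h -> measurable_fun setT (fun x => sabs (h x)).
Proof.
move=> [a b]; under eq_fun do rewrite sabsE.
apply: (measurableT_comp (continuous_measurable_fun (@sqrt_continuous R))).
by apply: measurable_funD; exact: measurable_funX.
Qed.

Lemma L0_coord f k : L0 f -> measurable_scal (fun x => f x 0 k).
Proof. by move=> /L0P. Qed.

Lemma L0_scale h f : measurable_scal h -> L0 f -> L0 (fun x => h x *: f x).
Proof.
move=> mh /L0P mf; apply/L0P => k.
by under eq_fun do rewrite mxE; exact: measurable_scalM.
Qed.

Lemma L0_add f g : L0 f -> L0 g -> L0 (f \+ g).
Proof.
move=> /L0P mf /L0P mg; apply/L0P => k; rewrite /=.
by under eq_fun do rewrite mxE; exact: measurable_scalD.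
Qed.

Lemma L0_cst (u : Fn) : L0 (cst u : Rd -> Fn).
Proof. by apply/L0P => k; exact: measurable_scal_cst. Qed.

Lemma L0_cutoff (G : set Rd) f : measurable G -> L0 f -> L0 (cutoff G f).
Proof. by move=> mG mf; exact: (L0_scale (measurable_scal_indic mG) mf). Qed.

Lemma measurable_scal_dot f g : L0 f -> L0 g -> measurable_scal (fun x => dot (f x) (g x)).
Proof.
move=> /L0P mf /L0P mg; rewrite /dot.
apply: (measurable_scal_sum _ (h := fun k x => f x 0 k * sconj (g x 0 k))).
by move=> k; apply: measurable_scalM; [exact: mf | apply: measurable_scal_conj; exact: mg].
Qed.

Lemma measurable_vabs f : L0 f -> measurable_fun setT (fun x => vabs (f x)).
Proof.
move=> /L0P mf; apply: (measurableT_comp (continuous_measurable_fun (@sqrt_continuous R))).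
by apply: measurable_sum => k; apply: measurable_funX; exact: measurable_sabs.
Qed.

End measurability.

(** * Closed symmetric convex sets *)

(** The identity that compares v with the multiple of u having the same
    coordinate k, given an approximation l u of v; see [closed_Ku]. *)
Lemma proportional_split (K : fieldType) (l uj uk vj vk : K) : uk != 0 ->
  vj - vk / uk * uj = - (l * uj - vj) + (l * uk - vk) * (uj / uk).
Proof. by move=> uk0; field. Qed.

Section rowsets.
Context (R : realType) (F : scalars) (n : nat).
Local Notation K := (scal R F).
Local Notation Fn := 'rV[scal R F]_n.
Implicit Types (u v w : Fn) (A U : set Fn) (l : K).

Lemma le_of_eps (a b C : R) : 0 <= C -> (forall e, 0 < e -> a <= b + C * e) -> a <= b.
Proof.
move=> C0 h; rewrite leNgt; apply/negP => ba.
have C1 : 0 < C + 1 by rewrite ltr_wpDl.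
pose e := (a - b) / (C + 1).
have e0 : 0 < e by rewrite divr_gt0 ?subr_gt0.
have eE : e * (C + 1) = a - b by rewrite divfK// gt_eqF.
by have := h e e0; lra.
Qed.

Lemma closure_rowP A u :
  closure A u <-> forall e : R, 0 < e -> exists2 v, A v & row_close e u v.
Proof.
split.
  move=> clA e e0; have [|v [Av uv]] := clA (row_close e u); last by exists v.
  by apply/nbhs_rowP; exists e.
by move=> h B /nbhs_rowP[e /h [v Av uv] eB]; exists v; split => //; exact: eB.
Qed.

Lemma Ku_scale l u : sabs l <= 1 -> Ku (l *: u) `<=` Ku u.
Proof.
move=> l1 _ [m m1 <-]; exists (m * l); last by rewrite scalerA.
rewrite /= in m1 *; rewrite sabs_le1 in m1; rewrite sabs_le1 sabsM.
by rewrite -[leRHS]mul1r ler_pM ?sabs_ge0.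
Qed.

Lemma KuP u v : Ku u v <-> exists2 l, sabs l <= 1 & v = l *: u.
Proof.
split=> [[l + <-]|[l l1 ->]]; first by rewrite /= sabs_le1 => l1; exists l.
by exists l => //=; rewrite sabs_le1.
Qed.

Lemma Ku_refl u : Ku u u.
Proof. by apply/KuP; exists 1; rewrite ?sabs1 ?scale1r. Qed.

Lemma Ku_mem u v : Ku u v -> Ku v `<=` Ku u.
Proof. by move=> /KuP[l l1 ->]; exact: Ku_scale. Qed.

(** For a limit v of multiples of u, and a coordinate k with u_k nonzero, the
    only candidate for the multiplier is v_k / u_k. *)
Lemma closed_Ku u : closed (Ku u).
Proof.
move=> v /closure_rowP clv.
have {}clv e : 0 < e -> exists2 l, sabs l <= 1 & forall j, sabs (l * u 0 j - v 0 j) < e.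
  move=> /clv [_ /KuP[l l1 ->] h]; exists l => // j.
  by have := h j; rewrite mxE.
have [u0|] := eqVneq u 0.
  apply/KuP; exists 0; rewrite ?sabs0 ?ler01// scale0r; apply/rowP => j.
  rewrite mxE; apply: sabs_eq0; apply/eqP; rewrite eq_le sabs_ge0 andbT.
  apply: (@le_of_eps _ _ 1) => // e /clv[l _ /(_ j)].
  by rewrite u0 mxE mulr0 sub0r sabsN mul1r add0r => /ltW.
rewrite -[u != 0]/(~~ _) => /eqP u0.
have [k uk] : exists k, u 0 k != 0.
  apply/not_existsP => h; apply: u0; apply/rowP => k; rewrite mxE.
  by apply/eqP; apply/negPn/negP/h.
have suk : 0 < sabs (u 0 k).
  by rewrite lt_def sabs_ge0 andbT; apply: contra_neq uk => /sabs_eq0.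
apply/KuP; exists (v 0 k / u 0 k).
  rewrite -(ler_pM2r suk) -sabsM divfK// mul1r.
  apply: (@le_of_eps _ _ 1) => // e /clv[l l1 /(_ k) h].
  rewrite -[v 0 k](subKr (l * u 0 k)) mul1r.
  apply: le_trans (sabsD _ _) _; rewrite sabsN; apply: lerD; last exact: ltW.
  by rewrite sabsM -[leRHS]mul1r ler_wpM2r// sabs_ge0.
apply/rowP => j; rewrite mxE; apply/eqP; rewrite -subr_eq0; apply/eqP/sabs_eq0.
apply/eqP; rewrite eq_le sabs_ge0 andbT.
apply: (@le_of_eps _ _ (1 + sabs (u 0 j / u 0 k))); first by rewrite addr_ge0// sabs_ge0.
move=> e /clv[l l1 h].
rewrite (_ : v 0 j - _ = - (l * u 0 j - v 0 j) + (l * u 0 k - v 0 k) * (u 0 j / u 0 k)); last first.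
  exact: proportional_split.
rewrite [leRHS](_ : _ = e + sabs (u 0 j / u 0 k) * e); last by ring.
apply: le_trans (sabsD _ _) _; rewrite sabsN.
apply: lerD; first exact/ltW/h.
by rewrite sabsM mulrC ler_wpM2l ?sabs_ge0// ltW.
Qed.

Lemma Kset_Ku u : Kset (Ku u).
Proof.
split.
- by exists u; exact: Ku_refl.
- exact: closed_Ku.
- move=> x y p; rewrite !inE => /KuP[a a1 ->] /KuP[b b1 ->].
  apply/KuP; exists (p%:num * a + (1 - p%:num) * b); last first.
    by rewrite scalerDl -!scalerA.
  rewrite -sabs_le1; apply: le_trans (ler_normD _ _) _.
  rewrite !normrM (@ger0_norm _ p%:num)// (@ger0_norm _ (1 - p%:num)) ?subr_ge0 ?le1//.
  rewrite -[leRHS](subrKC (p%:num) 1); apply: lerD.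
    by rewrite -[leRHS]mulr1 ler_wpM2l ?sabs_le1.
  by rewrite -[leRHS]mulr1 ler_wpM2l ?sabs_le1// subr_ge0 le1.
- move=> l v l1 /KuP[m m1 ->]; apply/KuP; exists (l * m); rewrite ?scalerA// sabsM.
  have : `|l| <= 1 by rewrite l1.
  rewrite sabs_le1 => l1'; by rewrite -[leRHS]mul1r ler_pM ?sabs_ge0.
Qed.

Lemma Kset_comb A u v (t : R) : Kset A -> A u -> A v -> 0 <= t <= 1 ->
  A (sr t *: u + sr (1 - t) *: v).
Proof.
case=> _ _ cA _ Au Av /andP[t0 t1].
have t0' : 0 <= (sr t : K) by rewrite -(@sr0 R F) sr_le.
have t1' : (sr t : K) <= 1 by rewrite -(@sr1 R F) sr_le.
have := cA u v (Itv01 t0' t1'); rewrite !inE => /(_ Au Av).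
by rewrite srD srN sr1.
Qed.

(** The midpoint of u and - u. *)
Lemma Kset0 A : Kset A -> A 0.
Proof.
move=> KA; have [[u Au] _ _ sA] := KA.
have Nu : A (- u) by rewrite -scaleN1r; apply: sA => //; rewrite normrN normr1.
have := @Kset_comb A u (- u) (2^-1) KA Au Nu.
rewrite invr_ge0 ler0n invf_le1 ?ler1n// => /(_ isT).
have e : 1 - 2^-1 = 2^-1 :> R by lra.
by rewrite scalerN e subrr.
Qed.

Lemma Kset_shrink A u (t : R) : Kset A -> A u -> 0 <= t <= 1 -> A (sr t *: u).
Proof.
by move=> KA Au t1; have := Kset_comb KA Au (Kset0 KA) t1; rewrite scaler0 addr0.
Qed.

End rowsets.

Section setvalued.
Context (R : realType) (F : scalars) (d n : nat).
Local Notation K := (scal R F).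
Local Notation Fn := 'rV[scal R F]_n.
Local Notation Rd := (Rd R d).
Implicit Types (f g : Rd -> Fn) (Phi : Rd -> set Fn).

(** K(f(x)) meets an open set U if and only if l f(x) belongs to U for one of
    countably many scalars l in the unit disc. *)
Lemma L0K_Ku f : L0 f -> L0K (fun x => Ku (f x)).
Proof.
move=> mf; split=> [x|U oU]; first exact: Kset_Ku.
pose lam (q : rat * rat) : K := smk F (ratr q.1) (ratr q.2).
rewrite (_ : [set x | _] = \bigcup_(q in [set q | sabs (lam q) <= 1])
    [set x | U (lam q *: f x)]).
  rewrite bigcup_mkcond; apply: countable_bigcupT_measurable; first exact: countableP.
  move=> q; case: ifPn => _; last exact: measurable0.
  exact: (L0_scale (measurable_scal_cst d (lam q)) mf).
apply/seteqP; split=> x /=; last first.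
  by move=> [q q1 Uq]; exists (lam q *: f x); split => //; apply/KuP; exists (lam q).
move=> [_ [/KuP[l l1 ->] Ul]].
have /nbhs_rowP[e e0 eU] : nbhs (l *: f x) U by exact: open_nbhs_nbhs.
pose M := 1 + \sum_(k < n) sabs (f x 0 k).
have M1 : 1 <= M by rewrite lerDl sumr_ge0// => k _; exact: sabs_ge0.
have M0 : 0 < M by exact: lt_le_trans M1.
have leM k : sabs (f x 0 k) <= M.
  by rewrite /M (bigD1 k)//= addrCA lerDl addr_ge0// sumr_ge0// => i _; exact: sabs_ge0.
(* l is first shrunk by the factor 1 - t, so that rational approximations of
   it stay in the closed unit disc *)
pose t := Num.min 1 (e / (2 * M)).
have t0 : 0 < t by rewrite lt_min ltr01 divr_gt0// mulr_gt0.
have t1 : t <= 1 by rewrite ge_min lexx.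
have tM : 2 * t * M <= e.
  rewrite mulrAC -ler_pdivlMl ?mulr_gt0// mulrC.
  by rewrite ge_min lexx orbT.
have t2 : 0 < t / 2 by rewrite divr_gt0.
have [a ha] := rat_near (sre (sr (1 - t) * l)) t2.
have [b hb] := rat_near (sim l * (1 - t)) t2.
(* over the reals the imaginary part is dropped, so its approximation must be 0 *)
pose q := (a, if F is RealScalars then 0 else b).
have lq : sabs (lam q - sr (1 - t) * l) < t.
  apply: le_lt_trans (sabs_reim _) _; rewrite sreB simB sim_srM /lam sre_smk /=.
  rewrite distrC [ltRHS](splitr t); apply: ltrD => //.
  clear -hb t2; rewrite mulrC; case: F l hb => /= l hb; first by rewrite mul0r subr0 normr0.
  by rewrite distrC.
have l1t : sabs (sr (1 - t) * l) <= 1 - t.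
  by rewrite sabsM sabs_sr ger0_norm ?subr_ge0// -[leRHS]mulr1 ler_wpM2l// subr_ge0.
exists q => /=.
  rewrite -(subrK (sr (1 - t) * l) (lam q)); apply: le_trans (sabsD _ _) _.
  by rewrite -[leRHS](subrKC t 1); apply: lerD => //; exact: ltW.
apply: eU => k; rewrite !mxE -mulrBl sabsM.
apply: (@lt_le_trans _ _ (2 * t * M)) => //.
apply: (@le_lt_trans _ _ (sabs (lam q - l) * M)); first by rewrite ler_wpM2l// sabs_ge0.
rewrite ltr_pM2r// -(subrKA (sr (1 - t) * l)).
apply: le_lt_trans (sabsD _ _) _; rewrite mulr_natl mulr2n; apply: ltr_leD => //.
rewrite -[X in _ - X]mul1r -mulrBl srD sr1 addrAC subrr add0r sabsM sabs_sr normrN gtr0_norm//.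
by rewrite -[leRHS]mulr1 ler_wpM2l// ltW.
Qed.

End setvalued.

(** * Averages and averaging operators *)

Section averages.
Context (R : realType) (F : scalars) (d n : nat).
Local Notation K := (scal R F).
Local Notation Fn := 'rV[scal R F]_n.
Local Notation Rd := (Rd R d).
Local Notation mu := (Leb R d).
Implicit Types (f g : Rd -> Fn) (h : Rd -> K) (Q G E : set Rd) (P : set (set Rd)).

Lemma cutoff_in G f x : G x -> cutoff G f x = f x.
Proof. by move=> Gx; rewrite /cutoff indicE mem_set// scale1r. Qed.

Lemma cutoff_out G f x : ~ G x -> cutoff G f x = 0.
Proof. by move=> Gx; rewrite /cutoff indicE memNset// scale0r. Qed.

Lemma sre_sint E h : sre (sint E h) = \int[mu]_(x in E) sre (h x).
Proof. exact: sre_smk. Qed.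

Lemma sim_sint E h : sim (sint E h) = \int[mu]_(x in E) sim (h x).
Proof.
rewrite /sint; case: F h => //= h; rewrite Rintegral_mkcond.
have z0 : (fun=> 0) \_ E = cst 0 :> (Rd -> R).
  by apply/funext => x; rewrite /patch; case: ifP.
by rewrite z0 Rintegral_cst// mul0r.
Qed.

Lemma sint_eq E h1 h2 : (forall x, E x -> h1 x = h2 x) -> sint E h1 = sint E h2.
Proof.
by move=> e; rewrite /sint; congr smk; apply: eq_Rintegral => x /set_mem /e ->.
Qed.

Lemma sint_subset E G h : G `<=` E ->
  sint E (fun x => (\1_G x : K) * h x) = sint G h.
Proof.
move=> GE; have GI : G = E `&` G by apply/esym/setIidPr.
apply: scal_eq; rewrite ?sre_sint ?sim_sint [in RHS]GI Rintegral_mkcondr.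
  apply: eq_Rintegral => x _; rewrite /patch indicE.
  by case: (x \in G); rewrite ?mul1r ?mul0r ?sre0.
apply: eq_Rintegral => x _; rewrite /patch indicE.
by case: (x \in G); rewrite ?mul1r ?mul0r ?sim0.
Qed.

Lemma avgE Q f k : avg Q f 0 k = sr (fine (mu Q))^-1 * sint Q (fun x => f x 0 k).
Proof. by rewrite /avg !mxE. Qed.

Lemma avg_eq Q f g : (forall x, Q x -> f x = g x) -> avg Q f = avg Q g.
Proof.
move=> e; apply/rowP => k; rewrite !avgE; congr (_ * _).
by apply: sint_eq => x /e ->.
Qed.

Lemma avg_cutoff_self Q f : avg Q (cutoff Q f) = avg Q f.
Proof. by apply: avg_eq => x Qx; exact: cutoff_in. Qed.

(** Enlarging the cube only rescales the average of a function supported in the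
    smaller one. *)
Lemma avg_cutoff Q Q' f : cube Q -> cube Q' -> Q `<=` Q' ->
  avg Q' (cutoff Q f) = sr (fine (mu Q) / fine (mu Q')) *: avg Q f.
Proof.
move=> cQ cQ' QQ'; apply/rowP => k; rewrite [RHS]mxE !avgE.
under [in LHS]eq_fun do rewrite mxE.
rewrite sint_subset// mulrA -srM; congr (sr _ * _).
have Q0 : fine (mu Q) != 0.
  by rewrite gt_eqF// fine_gt0// Leb_cube_gt0//= ltey_eq Leb_cube_fin.
by rewrite mulrAC divff// mul1r.
Qed.

Lemma vabs_coord (u : Fn) k : sabs (u 0 k) <= vabs u.
Proof.
rewrite /vabs -(ger0_norm (sabs_ge0 (u 0 k))) -sqrtr_sqr ler_sqrt.
  by rewrite (bigD1 k)//= lerDl sumr_ge0// => i _; exact: sqr_ge0.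
by rewrite sumr_ge0// => i _; exact: sqr_ge0.
Qed.

Lemma vabs_ge0 (u : Fn) : 0 <= vabs u. Proof. exact: sqrtr_ge0. Qed.

Lemma vabs_le_sum (u : Fn) : vabs u <= \sum_(k < n) sabs (u 0 k).
Proof.
have s0 : 0 <= \sum_(k < n) sabs (u 0 k).
  by rewrite sumr_ge0// => i _; exact: sabs_ge0.
rewrite /vabs -(ger0_norm s0) -sqrtr_sqr ler_sqrt ?sqr_ge0//.
have: forall s : seq 'I_n,
    \sum_(k <- s) sabs (u 0 k) ^+ 2 <= (\sum_(k <- s) sabs (u 0 k)) ^+ 2.
  elim=> [|k s IH]; first by rewrite !big_nil expr0n.
  rewrite !big_cons sqrrD -addrA lerD2l (le_trans IH)// lerDr mulrn_wge0//.
  by rewrite mulr_ge0 ?sabs_ge0// sumr_ge0// => i _; exact: sabs_ge0.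
exact.
Qed.

Lemma integrable_coord Q f k : measurable Q -> L0 f -> vintegrable Q f ->
  mu.-integrable Q (EFin \o (fun x => sre (f x 0 k))) /\
  mu.-integrable Q (EFin \o (fun x => sim (f x 0 k))).
Proof.
move=> mQ mf intf; have [m1 m2] := L0_coord k mf.
split; apply: (le_integrable _ _ _ intf) => //.
- by apply/measurable_EFinP; apply: measurable_funTS.
- move=> x _ /=; rewrite lee_fin [leRHS]ger0_norm ?vabs_ge0//.
  by apply: le_trans (vabs_coord _ k); exact: sre_sabs.
- by apply/measurable_EFinP; apply: measurable_funTS.
- move=> x _ /=; rewrite lee_fin [leRHS]ger0_norm ?vabs_ge0//.
  by apply: le_trans (vabs_coord _ k); exact: sim_sabs.
Qed.

Lemma avg_scale Q f (t : R) : measurable Q -> L0 f -> vintegrable Q f ->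
  avg Q (fun x => sr t *: f x) = sr t *: avg Q f.
Proof.
move=> mQ mf intf; apply/rowP => k; rewrite [RHS]mxE !avgE mulrCA; congr (_ * _).
have [i1 i2] := integrable_coord k mQ mf intf.
under [in LHS]eq_fun do rewrite mxE.
apply: scal_eq; rewrite ?sre_srM ?sim_srM ?sre_sint ?sim_sint -RintegralZl//.
  by apply: eq_Rintegral => x _; rewrite sre_srM.
by apply: eq_Rintegral => x _; rewrite sim_srM.
Qed.

Lemma avg_indic Q G k : cube Q -> measurable G -> G `<=` Q ->
  avg Q (cutoff G (cst (delta_mx 0 k))) =
  sr (fine (mu G) / fine (mu Q)) *: delta_mx 0 k :> Fn.
Proof.
move=> cQ mG GQ; apply/rowP => j; rewrite !avgE.
rewrite (@sint_eq _ _ (fun x => (\1_G x : K) * (j == k)%:R)); last first.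
  by move=> x _; rewrite !mxE eqxx.
rewrite sint_subset// !mxE eqxx /=.
have -> : sint G (fun=> (j == k)%:R : K) = sr (fine (mu G) * (j == k)%:R).
  apply: scal_eq.
    rewrite sre_sint Rintegral_cst// sre_sr mulrC; congr (_ * _).
    by case: (j == k); rewrite ?sre1 ?sre0.
  rewrite sim_sint Rintegral_cst// sim_sr.
  by case: (j == k); rewrite ?sim1 ?sim0 mul0r.
rewrite mulrC -srM; have -> : (j == k)%:R = sr (j == k)%:R :> K.
  by case: (j == k); rewrite ?sr1 ?sr0.
by rewrite -srM mulrAC.
Qed.

End averages.

Section T_operators.
Context (R : realType) (F : scalars) (d n : nat).
Local Notation K := (scal R F).
Local Notation Fn := 'rV[scal R F]_n.
Local Notation Rd := (Rd R d).
Implicit Types (f g : Rd -> Fn) (h : Rd -> K) (Q G E : set Rd) (P : set (set Rd)).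

Lemma T_op_in P f Q x : trivIset P id -> P Q -> Q x -> T_op P f x = avg Q f.
Proof.
move=> tP PQ Qx; rewrite /T_op -(@fsbig_widen _ _ _ _ [set Q]).
- by rewrite fsbig_set1 indicE mem_set// scale1r.
- by move=> _ ->.
move=> Q' [PQ' nQ] /=; rewrite indicE memNset ?scale0r// => Q'x.
by apply: nQ; apply: tP => //; exists x.
Qed.

Lemma T_op_out P f x : ~ (\bigcup_(Q in P) Q) x -> T_op P f x = 0.
Proof.
move=> nP; rewrite /T_op fsbig1// => Q PQ; rewrite indicE memNset ?scale0r//.
by move=> Qx; apply: nP; exists Q.
Qed.

Lemma T_op_set1 Q f : T_op [set Q] f = cutoff Q (cst (avg Q f)).
Proof.
apply/funext => x; have [Qx|nQx] := pselect (Q x).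
  rewrite cutoff_in// (@T_op_in _ _ Q)//.
  by move=> A B -> ->.
by rewrite cutoff_out// T_op_out// bigcup_set1.
Qed.

Lemma cube_family_set1 Q : cube Q -> cube_family [set Q].
Proof. by move=> cQ; split => [_ ->//|A B -> ->]. Qed.

(** The preimage of an open set is a union of cubes of the family, together with
    the complement of their union if the open set contains 0. *)
Lemma L0_T_op P f : cube_family P -> L0 (T_op P f).
Proof.
move=> [cP tP] U oU.
have mU (P' : set (set Rd)) : P' `<=` P -> measurable (\bigcup_(Q in P') Q).
  by move=> P'P; apply: measurable_bigcup_cube => Q /P'P /cP.
rewrite (_ : _ @^-1` U = (\bigcup_(Q in [set Q | P Q /\ U (avg Q f)]) Q) `|`
   (if `[<U 0>] then ~` (\bigcup_(Q in P) Q) else set0)).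
  apply: measurableU; first by apply: mU => Q [].
  case: ifP => _; last exact: measurable0.
  by apply: measurableC; exact: mU.
apply/seteqP; split=> x /=.
  move=> UT; have [[Q PQ Qx]|nP] := pselect ((\bigcup_(Q in P) Q) x).
    by left; exists Q => //; split => //; rewrite -(@T_op_in P f Q x).
  by right; rewrite T_op_out// in UT; rewrite (asboolT UT).
case=> [[Q [PQ UQ] Qx]|]; first by rewrite (T_op_in _ tP PQ).
by case: ifPn => // /asboolP U0 nP; rewrite T_op_out.
Qed.

End T_operators.

(** * Hoelder's inequality and the Fatou property *)

Section function_spaces.
Context (R : realType) (F : scalars) (d n : nat).
Local Notation K := (scal R F).
Local Notation Fn := 'rV[scal R F]_n.
Local Notation Rd := (Rd R d).
Local Notation mu := (Leb R d).
Implicit Types (f g : Rd -> Fn) (h : Rd -> K) (Q G E : set Rd) (P : set (set Rd)).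

Definition pairing f g : \bar R := \int[mu]_x (sabs (dot (f x) (g x)))%:E.

Lemma pairing_ge0 f g : (0 <= pairing f g)%E.
Proof. by apply: integral_ge0 => x _; rewrite lee_fin sabs_ge0. Qed.

Lemma measurable_pairing f g : L0 f -> L0 g ->
  measurable_fun setT (fun x => (sabs (dot (f x) (g x)))%:E).
Proof. by move=> mf mg; apply/measurable_EFinP/measurable_sabs/measurable_scal_dot. Qed.

Lemma sabs_dotC (u v : Fn) : sabs (dot u v) = sabs (dot v u).
Proof.
rewrite -sabs_conj; congr sabs; apply: scal_eq; rewrite ?sconj_re ?sconj_im /dot.
  rewrite !(big_morph _ (@sreD R F) (@sre0 R F)); apply: eq_bigr => k _.
  by rewrite !sreM !sconj_re !sconj_im; ring.
rewrite !(big_morph _ (@simD R F) (@sim0 R F)) -sumrN; apply: eq_bigr => k _.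
by rewrite !simM !sconj_re !sconj_im; ring.
Qed.

Lemma pairingC f g : pairing f g = pairing g f.
Proof. by apply: eq_integral => x _; rewrite sabs_dotC. Qed.

Lemma dotZl (l : K) (u v : Fn) : dot (l *: u) v = l * dot u v.
Proof. by rewrite /dot mulr_sumr; apply: eq_bigr => k _; rewrite mxE mulrA. Qed.

Lemma dot0l (v : Fn) : dot 0 v = 0.
Proof. by rewrite /dot big1// => k _; rewrite mxE mul0r. Qed.

Lemma dot_delta (u : Fn) k : dot u (delta_mx 0 k) = u 0 k.
Proof.
rewrite /dot (bigD1 k)//= big1; last first.
  move=> j jk; rewrite mxE (negPf jk) andbF.
  rewrite (_ : sconj 0 = 0) ?mulr0//.
  by apply: scal_eq; rewrite ?sconj_re ?sconj_im ?sim0 ?oppr0.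
rewrite addr0 mxE !eqxx /= (_ : sconj 1 = 1) ?mulr1//.
by apply: scal_eq; rewrite ?sconj_re ?sconj_im ?sim1 ?oppr0.
Qed.

Lemma pairing_scale (l : K) f g : L0 f -> L0 g ->
  pairing (fun x => l *: f x) g = ((sabs l)%:E * pairing f g)%E.
Proof.
move=> mf mg; pose p x := (sabs (dot (f x) (g x)))%:E.
have p0 x : setT x -> (0 <= p x)%E by rewrite lee_fin sabs_ge0.
have l0 : (0 <= (sabs l)%:E)%E by rewrite lee_fin sabs_ge0.
rewrite -[RHS](ge0_integralZl mu measurableT (measurable_pairing mf mg) p0 l0).
by apply: eq_integral => x _; rewrite dotZl sabsM EFinM.
Qed.

Variable X : fspace R F d n.
Hypothesis HX : directional_BFS X.

(** The directional ideal property, with the inclusion of the sets K reduced to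
    membership. *)
Lemma bfs_dom f g : fcar X f -> L0 g -> {ae mu, forall x, Ku (f x) (g x)} ->
  fcar X g /\ fnorm X g <= fnorm X f.
Proof.
move=> Xf mg fg; apply: (dbfs_ideal HX) => //.
by apply: filterS fg => x; exact: Ku_mem.
Qed.

Lemma bfs_domT f g : fcar X f -> L0 g -> (forall x, Ku (f x) (g x)) ->
  fcar X g /\ fnorm X g <= fnorm X f.
Proof. by move=> Xf mg fg; apply: bfs_dom => //; apply: aeW. Qed.

Lemma Ku_cutoff G f x : Ku (f x) (cutoff G f x).
Proof.
apply/KuP; exists (\1_G x) => //.
by rewrite indicE; case: (x \in G); rewrite ?sabs1 ?sabs0 ?ler01.
Qed.

Lemma bfs_cutoff G f : measurable G -> fcar X f ->
  fcar X (cutoff G f) /\ fnorm X (cutoff G f) <= fnorm X f.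
Proof.
move=> mG Xf; apply: bfs_domT => //; last exact: Ku_cutoff.
by apply: L0_cutoff => //; exact: (dbfs_L0 HX).
Qed.

Lemma bfs_norm0 : fnorm X (cst 0) = 0.
Proof.
have := dbfs_normZ HX 0 (dbfs_zero HX); rewrite sabs0 mul0r => <-.
by congr fnorm; apply/funext => x; rewrite scale0r.
Qed.

Lemma bfs_sum (I : Type) (s : seq I) (f : I -> Rd -> Fn) :
  (forall i, fcar X (f i)) ->
  fcar X (fun x => \sum_(i <- s) f i x) /\
  fnorm X (fun x => \sum_(i <- s) f i x) <= \sum_(i <- s) fnorm X (f i).
Proof.
move=> Xf; elim: s => [|i s [IH1 IH2]].
  have -> : (fun x : Rd => \sum_(i <- [::]) f i x) = cst 0.
    by apply/funext => x; rewrite big_nil.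
  by rewrite bfs_norm0 big_nil; split => //; exact: (dbfs_zero HX).
have -> : (fun x => \sum_(j <- i :: s) f j x) = f i \+ (fun x => \sum_(j <- s) f j x).
  by apply/funext => x; rewrite big_cons.
rewrite big_cons; split; first exact: (dbfs_add HX).
by apply: le_trans (dbfs_normD HX _ _) _ => //; rewrite lerD2l.
Qed.

Lemma dual_norm_bound f g : fcar X f -> fnorm X f = 1 -> fcar (kothe_dual X) g ->
  (pairing f g <= (fnorm (kothe_dual X) g)%:E)%E.
Proof.
move=> Xf f1 [_ /= goo].
have fg : (pairing f g <= dual_norm X g)%E by apply: ereal_sup_ubound; exists f.
by rewrite fineK// ge0_fin_numE// (le_trans _ fg)// pairing_ge0.
Qed.

Lemma fnorm_inv_scale f : fcar X f -> fnorm X f != 0 ->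
  fcar X (fun x => sr (fnorm X f)^-1 *: f x) /\
  fnorm X (fun x => sr (fnorm X f)^-1 *: f x) = 1.
Proof.
move=> Xf f0; split; first exact: (dbfs_scale HX).
rewrite (dbfs_normZ HX)// sabs_sr ger0_norm ?invr_ge0 ?(dbfs_norm_ge0 HX)//.
by rewrite mulVf.
Qed.

(** If the norm of f vanishes then f = 0 a.e.; otherwise f is normalized. *)
Lemma holder f g : fcar X f -> fcar (kothe_dual X) g ->
  (pairing f g <= (fnorm X f * fnorm (kothe_dual X) g)%:E)%E.
Proof.
move=> Xf Yg; have mf := dbfs_L0 HX Xf; have mg := Yg.1.
have [f0|f0] := eqVneq (fnorm X f) 0.
  rewrite f0 mul0r (_ : pairing f g = \int[mu]_x (cst 0%E x))%E.
    by rewrite integral0.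
  have z0 (x : Rd) : setT x -> (0 <= cst (0%E : \bar R) x)%E by [].
  have p0 (x : Rd) : setT x -> (0 <= (sabs (dot (f x) (g x)))%:E)%E.
    by rewrite lee_fin sabs_ge0.
  have mz : measurable_fun [set: Rd] (cst (0%E : \bar R)) := measurable_cst _.
  rewrite /pairing; apply: (@ge0_ae_eq_integral _ _ _ mu _ _ _ measurableT
    (measurable_pairing mf mg) mz p0 z0).
  apply: filterS (dbfs_norm_eq0 HX Xf f0) => x fx _.
  by rewrite fx dot0l sabs0.
have [Xf' f1] := fnorm_inv_scale Xf f0.
have := dual_norm_bound Xf' f1 Yg.
rewrite pairing_scale// sabs_sr ger0_norm ?invr_ge0 ?(dbfs_norm_ge0 HX)//.
rewrite lee_pdivrMl// lt_def f0; exact: (dbfs_norm_ge0 HX).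
Qed.

Hypothesis refl_X : kothe_reflexive X.

(** Koethe reflexivity as a criterion for membership in X. *)
Lemma bidual_bound f (c : R) : L0 f -> 0 <= c ->
  (forall g, fcar (kothe_dual X) g -> fnorm (kothe_dual X) g = 1 ->
     (pairing f g <= c%:E)%E) ->
  fcar X f /\ fnorm X f <= c.
Proof.
move=> mf c0 h; case: refl_X => carE normE'.
have fc : (dual_norm (kothe_dual X) f <= c%:E)%E.
  by apply: ge_ereal_sup => _ [g [Yg g1] <-]; rewrite -/(pairing g f) pairingC; exact: h.
have Xf : fcar X f.
  by rewrite -carE; split => //; apply: le_lt_trans fc _; exact: ltry.
split => //; rewrite -normE'//=; move: fc; case: dual_norm => //=.
Qed.

(** For g in X', the pairing of g with f over the union of the E k is the limit of
    the pairings over the finite unions, which Hoelder's inequality bounds; so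
    [bidual_bound] applies. *)
Lemma fatou_property (E : nat -> set Rd) f (c : R) : L0 f -> 0 <= c ->
  (forall k, measurable (E k)) ->
  (forall N, let EN := \bigcup_(k in `I_N) E k in
     fcar X (cutoff EN f) /\ fnorm X (cutoff EN f) <= c) ->
  fcar X (cutoff (\bigcup_k E k) f) /\ fnorm X (cutoff (\bigcup_k E k) f) <= c.
Proof.
move=> mf c0 mE h.
have mU : measurable (\bigcup_k E k) by exact: bigcupT_measurable.
have mUN N : measurable (\bigcup_(k in `I_N) E k) by exact: bigcup_measurable.
apply: bidual_bound => //; first exact: L0_cutoff.
move=> g Yg g1; have mg := Yg.1.
have pE A : measurable A ->
    pairing (cutoff A f) g = (\int[mu]_(x in A) (sabs (dot (f x) (g x)))%:E)%E.
  move=> mA; rewrite [RHS]integral_mkcond; apply: eq_integral => x _.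
  rewrite /patch; case: ifPn => [/set_mem xA|/negP xA]; first by rewrite cutoff_in.
  by rewrite cutoff_out ?dot0l ?sabs0// => xA'; apply: xA; exact: mem_set.
have UE : \bigcup_k E k = \bigcup_N \bigcup_(k in `I_N) E k.
  apply/seteqP; split=> x [k _ Ekx]; first by exists k.+1 => //; exists k => //=.
  by case: Ekx => j _ Ejx; exists j.
rewrite pE// UE.
pose EN N := \bigcup_(k in `I_N) E k.
pose p x := (sabs (dot (f x) (g x)))%:E.
have nd : nondecreasing_seq EN.
  move=> i j ij; apply/subsetPset => x [k /= ki Ekx]; exists k => //=.
  exact: leq_trans ki ij.
have mp N : measurable_fun (EN N) p.
  by apply: measurable_funTS; exact: measurable_pairing.
have p0 N x : EN N x -> (0 <= p x)%E by rewrite lee_fin sabs_ge0.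
rewrite -(cvg_lim _ (ge0_nondecreasing_set_cvg_integral (mu := mu) nd mUN mp p0))//.
apply: lime_le.
  apply: ereal_nondecreasing_is_cvgn.
  exact: (ge0_nondecreasing_set_nondecreasing_integral mu nd mUN mp p0).
apply: nearW => N; rewrite -(pE _ (mUN N)).
have [XN cN] := h N; apply: le_trans (holder XN Yg) _.
by rewrite g1 mulr1 lee_fin.

Qed.

End function_spaces.

(** * Bounded averages and indicators of cubes *)

Section operator_bounds.
Context (R : realType) (F : scalars) (d n : nat).
Local Notation K := (scal R F).
Local Notation Fn := 'rV[scal R F]_n.
Local Notation Rd := (Rd R d).
Local Notation mu := (Leb R d).
Implicit Types (f g : Rd -> Fn) (h : Rd -> K) (Q G E : set Rd) (P : set (set Rd)).
Variable X : fspace R F d n.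
Hypothesis HX : directional_BFS X.

Lemma T_norm_ge0 P : (0 <= T_norm X P)%E.
Proof. by apply: le_ereal_inf_tmp => _ [c [c0 _] <-]; rewrite lee_fin. Qed.

Lemma T_norm_le P c : T_bound X P c -> (T_norm X P <= c%:E)%E.
Proof. by move=> bc; apply: ereal_inf_lbound; exists c. Qed.

(** The infimum defining the operator norm is attained. *)
Lemma T_norm_bound P (c : R) : (T_norm X P <= c%:E)%E -> T_bound X P c.
Proof.
move=> Pc; have c0 : 0 <= c by rewrite -lee_fin (le_trans (T_norm_ge0 P)).
have ex e : 0 < e -> exists2 b, T_bound X P b & b < c + e.
  move=> e0; have /ereal_inf_lt[_ [b bb <-]] : (T_norm X P < (c + e)%:E)%E.
    by apply: le_lt_trans Pc _; rewrite lte_fin ltrDl.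
  by rewrite lte_fin; exists b.
split=> // f Xf.
have [b [b0 /(_ f Xf) [intf XT _]] _] := ex 1 ltr01.
split=> //; apply: (le_of_eps (dbfs_norm_ge0 HX Xf)) => e /ex[b' [_ /(_ f Xf)[_ _ Tb]] b'c].
apply: le_trans Tb _; rewrite [X in _ + X]mulrC -mulrDl ler_wpM2r// ?(dbfs_norm_ge0 HX)//.
exact: ltW.
Qed.

Lemma A_le_Astrong : (A_const X <= Astrong_const X)%E.
Proof.
apply: ge_ereal_sup => _ [Q cQ <-]; apply: ereal_sup_ubound.
by exists [set Q] => //; exact: cube_family_set1.
Qed.

Lemma unit_cube :
  cube (box [tuple (0 : R) | i < d] 1 (fun=> true) (fun=> true) : set Rd).
Proof. by exists [tuple (0 : R) | i < d], 1, (fun=> true), (fun=> true); split. Qed.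

Lemma A_const_ge0 : (0 <= A_const X)%E.
Proof.
apply: le_trans (T_norm_ge0
  [set (box [tuple (0 : R) | i < d] 1 (fun=> true) (fun=> true) : set Rd)]) _.
by apply: ereal_sup_ubound; eexists => //; exact: unit_cube.
Qed.

Lemma A_const_bound (c : R) : (A_const X <= c%:E)%E ->
  forall Q, cube Q -> T_bound X [set Q] c.
Proof.
move=> Ac Q cQ; apply: T_norm_bound; apply: le_trans Ac.
by apply: ereal_sup_ubound; exists Q.
Qed.

Lemma Astrong_const_bound (c : R) : (Astrong_const X <= c%:E)%E ->
  forall P, cube_family P -> T_bound X P c.
Proof.
move=> Ac P cP; apply: T_norm_bound; apply: le_trans Ac.
by apply: ereal_sup_ubound; exists P.
Qed.

Lemma pairing_delta f Q k : measurable Q ->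
  pairing f (cutoff Q (cst (delta_mx 0 k))) = (\int[mu]_(x in Q) (sabs (f x 0 k))%:E)%E.
Proof.
move=> mQ; rewrite [RHS]integral_mkcond; apply: eq_integral => x _.
rewrite sabs_dotC /patch; case: ifPn => [/set_mem xQ|/negP xQ].
  by rewrite cutoff_in// sabs_dotC dot_delta.
by rewrite cutoff_out ?dot0l ?sabs0// => xA'; apply: xQ; exact: mem_set.
Qed.

(** The unimodular factor turning z into |z|, and 0 at z = 0. *)
Definition phase (z : K) : K := sr (sabs z)^-1 * sconj z.

Lemma phaseE z : phase z * z = sr (sabs z).
Proof.
rewrite /phase -mulrA (mulrC (sconj z)) mul_sconj -srM; congr sr.
have [->|z0] := eqVneq (sabs z) 0; first by rewrite expr0n mulr0.
by rewrite expr2 mulKf.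
Qed.

Lemma phase_le1 z : sabs (phase z) <= 1.
Proof.
rewrite /phase sabsM sabs_conj sabs_sr ger0_norm ?invr_ge0 ?sabs_ge0//.
have [->|z0] := eqVneq (sabs z) 0; first by rewrite mulr0.
by rewrite mulVf.
Qed.

Lemma measurable_scal_phase h : measurable_scal h -> measurable_scal (fun x => phase (h x)).
Proof.
move=> mh; have mi : measurable_scal (fun x => sr (sabs (h x))^-1 : K).
  apply: measurable_scal_sr; under eq_fun do rewrite -(powR_inv1 (sabs_ge0 _)).
  exact: (measurableT_comp (@measurable_powR R (-1)) (measurable_sabs mh)).
exact: (measurable_scalM mi (measurable_scal_conj mh)).
Qed.

Hypotheses (satX : saturated X) (satX' : saturated (kothe_dual X)).

Lemma fine_Leb_gt0 Q G : cube Q -> measurable G -> G `<=` Q -> (0 < mu G)%E ->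
  0 < fine (mu G).
Proof.
move=> cQ mG GQ G0; apply: fine_gt0; rewrite G0 /=.
apply: (@le_lt_trans _ _ (mu Q)); last by rewrite ltey_eq Leb_cube_fin.
by apply: le_measure; rewrite ?inE//; exact: measurable_cube.
Qed.

Lemma cube_fine_gt0 Q : cube Q -> 0 < fine (mu Q).
Proof.
move=> cQ; apply: (@fine_Leb_gt0 Q Q) => //; first exact: measurable_cube.
exact: Leb_cube_gt0.
Qed.

(** Multiply f by the phase of f_k: this does not increase the norm and makes f_k
    nonnegative, so that the integral of |f_k| is a coordinate of an average v.
    If G is contained in Q and 1_G e_k is in X', pairing 1_Q v with 1_G e_k bounds
    that coordinate by the norm of 1_Q v, which is at most c. *)
Lemma coordinate_integral_bound (c : R) Q k : 0 <= c -> cube Q ->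
  T_bound X [set Q] c ->
  exists2 B : R, 0 <= B & forall f, fcar X f -> fnorm X f <= 1 ->
    (\int[mu]_(x in Q) (sabs (f x 0 k))%:E <= B%:E)%E.
Proof.
move=> c0 cQ [_ bT]; have mQ := measurable_cube cQ.
have [G [mG GQ G0 XG]] := satX' k mQ (Leb_cube_gt0 cQ).
have G0' := fine_Leb_gt0 cQ mG GQ G0.
have Q0 := cube_fine_gt0 cQ.
have muG : mu G = (fine (mu G))%:E.
  rewrite fineK// ge0_fin_numE//; apply: (@le_lt_trans _ _ (mu Q)).
    by apply: le_measure; rewrite ?inE.
  by rewrite ltey_eq Leb_cube_fin.
pose D := `|fnorm (kothe_dual X) (cutoff G (cst (delta_mx 0 k)))|.
have D0 : 0 <= D := normr_ge0 _.
have GD : 0 <= fine (mu Q) * (c * D / fine (mu G)).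
  by apply: mulr_ge0; [exact: ltW | apply: divr_ge0; [exact: mulr_ge0 c0 D0 | exact: ltW]].
exists (fine (mu Q) * (c * D / fine (mu G))) => // f Xf f1.
have mf := dbfs_L0 HX Xf.
pose h x := phase (f x 0 k) *: f x.
have mh : L0 h := L0_scale (measurable_scal_phase (L0_coord k mf)) mf.
have [Xh hf] : fcar X h /\ fnorm X h <= fnorm X f.
  apply: bfs_domT => // x; apply/KuP; exists (phase (f x 0 k)) => //.
  exact: phase_le1.
have [intv XT Tb] := bT h Xh.
pose v := avg Q h.
rewrite T_op_set1 -/v in XT Tb.
have hk x : h x 0 k = sr (sabs (f x 0 k)) by rewrite mxE phaseE.
have [ih _] := integrable_coord k mQ mh (intv Q erefl).
have {}ih : mu.-integrable Q (fun x => (sabs (f x 0 k))%:E).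
  by move: ih; congr (_.-integrable _ _); apply/funext => x /=; rewrite hk sre_sr.
have vk : fine (mu Q) * sabs (v 0 k) >= \int[mu]_(x in Q) sabs (f x 0 k).
  apply: (@le_trans _ _ (fine (mu Q) * sre (v 0 k))); last first.
    by rewrite ler_pM2l// (le_trans (ler_norm _))// sre_sabs.
  rewrite /v avgE sre_srM mulrA divff ?gt_eqF// mul1r sre_sint.
  by rewrite le_eqVlt; apply/orP; left; apply/eqP/eq_Rintegral => x _; rewrite hk sre_sr.
rewrite -[leLHS]fineK ?integrable_fin_num// lee_fin.
apply: le_trans vk _; rewrite ler_pM2l// ler_pdivlMr//.
have := holder HX XT XG; rewrite pairing_delta//.
rewrite (@eq_integral _ _ _ mu G (cst (sabs (v 0 k))%:E)); last first.
  by move=> x /set_mem /GQ Qx; rewrite cutoff_in.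
rewrite integral_cst// muG -EFinM lee_fin => /le_trans; apply.
apply: (@le_trans _ _ (fnorm X (cutoff Q (cst v)) * D)).
  by rewrite ler_wpM2l ?(dbfs_norm_ge0 HX)// ler_norm.
rewrite ler_wpM2r//; apply: le_trans Tb _.
by rewrite -[leRHS]mulr1 ler_wpM2l// (le_trans hf).
Qed.

Lemma bfs_cutoff_cst Q u : measurable Q ->
  (forall k, fcar X (cutoff Q (cst (delta_mx 0 k)))) -> fcar X (cutoff Q (cst u)).
Proof.
move=> mQ XQ.
have [+ _] := bfs_sum HX (index_enum 'I_n)
  (f := fun k x => u 0 k *: cutoff Q (cst (delta_mx 0 k)) x)
  (fun k => dbfs_scale HX (u 0 k) (XQ k)).
congr fcar; apply/funext => x; rewrite /cutoff [in RHS]/cst /=.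
under eq_bigr do rewrite scalerA mulrC -scalerA.
by rewrite -scaler_sumr -row_sum_delta.
Qed.

(** If G is contained in Q and 1_G e_k is in X, its average over Q is a nonzero
    multiple of e_k, so 1_Q e_k is in X.  For X' see [coordinate_integral_bound]. *)
Lemma cube_indicators_of_T_bound (c : R) : 0 <= c ->
  (forall Q, cube Q -> T_bound X [set Q] c) -> has_cube_indicators X.
Proof.
move=> c0 bT Q u cQ; have mQ := measurable_cube cQ; split.
  apply: bfs_cutoff_cst => // k.
  have [G [mG GQ G0 XG]] := satX k mQ (Leb_cube_gt0 cQ).
  have [_ /(_ _ XG)[_ XT _]] := bT Q cQ.
  rewrite T_op_set1 avg_indic// in XT.
  pose r := fine (mu G) / fine (mu Q); rewrite -/r in XT.
  have r0 : r != 0.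
    by rewrite gt_eqF// divr_gt0//; [exact: fine_Leb_gt0 GQ G0 | exact: cube_fine_gt0].
  have := dbfs_scale HX (sr r^-1) XT; congr fcar; apply/funext => x.
  rewrite /cutoff /cst /= scalerA mulrC -scalerA; congr (_ *: _).
  by rewrite scalerA -srM mulVf// sr1 scale1r.
split; first by apply: L0_cutoff => //; exact: L0_cst.
pose B k := projT1 (cid2 (coordinate_integral_bound k c0 cQ (bT Q cQ))).
have BP k f : fcar X f -> fnorm X f <= 1 ->
    (\int[mu]_(x in Q) (sabs (f x 0 k))%:E <= (B k)%:E)%E.
  by rewrite /B; case: cid2 => /= b b0; exact.
apply: (@le_lt_trans _ _ (\sum_(k < n) (sabs (u 0 k) * B k))%:E); last exact: ltry.
apply: ge_ereal_sup => _ [f [Xf f1] <-].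
have mf := dbfs_L0 HX Xf.
pose q k (x : Rd) := ((sabs (f x 0 k))%:E : \bar R).
have q0 k (x : Rd) : Q x -> (0 <= q k x)%E by rewrite lee_fin sabs_ge0.
have mq k : measurable_fun Q (q k).
  apply: measurable_funTS; apply/measurable_EFinP.
  exact/measurable_sabs/L0_coord.
pose w k (x : Rd) := ((sabs (u 0 k))%:E * q k x)%E.
have u0 k : (0 <= (sabs (u 0 k))%:E)%E by rewrite lee_fin sabs_ge0.
have w0 k (x : Rd) : Q x -> (0 <= w k x)%E by move=> Qx; rewrite mule_ge0// q0.
have mw k : measurable_fun Q (w k) := measurable_funeM _ (mq k).
pose W (x : Rd) := (\sum_(k < n) w k x)%E.
have mW : measurable_fun setT (W \_ Q).
  by have := emeasurable_sum (index_enum 'I_n) mw => /(measurable_restrictT _ mQ).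
apply: (@le_trans _ _ (\int[mu]_(x in Q) W x)%E).
  rewrite [leRHS]integral_mkcond.
  have mQu : L0 (cutoff Q (cst u)) by apply: L0_cutoff => //; exact: L0_cst.
  have p0 (x : Rd) : setT x -> (0 <= (sabs (dot (f x) (cutoff Q (cst u) x)))%:E)%E.
    by rewrite lee_fin sabs_ge0.
  apply: (ge0_le_integral mu measurableT p0 (measurable_pairing mf mQu) mW).
  move=> x _; rewrite /patch; case: ifPn => [/set_mem xQ|/negP xQ]; last first.
    by rewrite sabs_dotC cutoff_out ?dot0l ?sabs0// => xA'; apply: xQ; exact: mem_set.
  rewrite cutoff_in// /W /w /q; under eq_bigr do rewrite -EFinM.
  rewrite sumEFin lee_fin /dot.
  elim/big_ind2: _ => [|a b a' b' ab ab'|k _]; first by rewrite sabs0.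
    by apply: le_trans (sabsD _ _) _; exact: lerD.
  by rewrite sabsM sabs_conj mulrC.
rewrite (ge0_integral_sum mu mQ mw w0) -sumEFin; apply: lee_sum => k _.
rewrite (ge0_integralZl mu mQ (mq k) (q0 k) (u0 k)).
by rewrite EFinM lee_wpmul2l ?BP ?f1.
Qed.

End operator_bounds.

(** * From maximal operators to averaging operators *)

Section implications.
Context (R : realType) (F : scalars) (d n : nat).
Local Notation K := (scal R F).
Local Notation Fn := 'rV[scal R F]_n.
Local Notation Rd := (Rd R d).
Local Notation mu := (Leb R d).
Implicit Types (f g : Rd -> Fn) (h : Rd -> K) (Q G E : set Rd) (P : set (set Rd)).
Variable X : fspace R F d n.
Hypothesis HX : directional_BFS X.

Lemma S0_Ku_dom f g : fcar X f -> S0 (fun x => Ku (f x)) g ->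
  fcar X g /\ fnorm X g <= fnorm X f.
Proof. by move=> Xf [mg fg]; exact: bfs_dom. Qed.

Lemma XK_Ku f : fcar X f ->
  XK X (fun x => Ku (f x)) /\
  (XKnorm X (fun x => Ku (f x)) <= (fnorm X f)%:E)%E.
Proof.
move=> Xf; split.
  split; first by apply: L0K_Ku; exact: (dbfs_L0 HX).
  by exists (fnorm X f) => g /(S0_Ku_dom Xf).
apply: ge_ereal_sup => _ [g /(S0_Ku_dom Xf)[_ gf] <-].
by rewrite lee_fin.
Qed.

Lemma L1locK_vintegrable (Phi : Rd -> set Fn) Q f : L1locK Phi -> cube Q ->
  S0 (cutoffK Q Phi) f -> vintegrable Q f.
Proof.
move=> [_ /(_ Q) h] cQ Sf; have [c /(_ f Sf) fc] := h cQ.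
have mQ := measurable_cube cQ.
have mv : measurable_fun [set: Rd] (fun x => (vabs (f x))%:E).
  by apply/measurable_EFinP/measurable_vabs; exact: Sf.1.
apply/integrableP; split; first exact: measurable_funTS mv.
apply: le_lt_trans (ltry c); apply: le_trans fc.
have v0 (x : Rd) : setT x -> (0 <= (vabs (f x))%:E)%E by rewrite lee_fin vabs_ge0.
apply: le_trans (ge0_subset_integral mu mQ measurableT mv v0 (@subsetT _ Q)).
rewrite le_eqVlt; apply/orP; left; apply/eqP; apply: eq_integral => x _.
by rewrite /= ger0_norm// vabs_ge0.
Qed.

Lemma vintegrable_eq Q f g : measurable Q -> (forall x, Q x -> f x = g x) ->
  vintegrable Q f -> vintegrable Q g.
Proof.
by move=> mQ fg; apply: eq_integrable => // x /set_mem /fg ->.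
Qed.

Lemma S0_cutoffK (Phi : Rd -> set Fn) Q f : measurable Q -> S0 Phi f ->
  S0 (cutoffK Q Phi) (cutoff Q f).
Proof.
move=> mQ [mf ff]; split; first exact: L0_cutoff.
apply: filterS ff => x fx; rewrite /cutoffK; case: ifPn => xQ.
  by rewrite cutoff_in//; exact: set_mem.
by rewrite cutoff_out//= => Qx; move/negP: xQ; apply; exact: mem_set.
Qed.

Lemma S0_cutoffK_sub (Phi : Rd -> set Fn) Q f : (forall x, Kset (Phi x)) ->
  S0 (cutoffK Q Phi) f -> S0 Phi f.
Proof.
move=> KP [mf ff]; split => //; apply: filterS ff => x; rewrite /cutoffK.
by case: ifPn => // _ ->; exact: Kset0.
Qed.

(** The average over Q of f is that of the selection 1_Q f of K(f) 1_Q. *)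
Lemma L1locK_Ku f Q : XK X `<=` @L1locK R F d n -> fcar X f -> cube Q ->
  vintegrable Q f /\ avgK Q (fun x => Ku (f x)) (avg Q f).
Proof.
move=> XL Xf cQ; have mQ := measurable_cube cQ.
have SQ : S0 (cutoffK Q (fun x => Ku (f x))) (cutoff Q f).
  apply: S0_cutoffK => //; split; first exact: (dbfs_L0 HX).
  by apply: aeW => x; exact: Ku_refl.
split; last by exists (cutoff Q f) => //; exact: avg_cutoff_self.
have LK := XL _ (XK_Ku Xf).1.
by apply: (vintegrable_eq mQ _ (L1locK_vintegrable LK cQ SQ)) => x Qx; exact: cutoff_in.
Qed.

Lemma M_op_avg (Phi : Rd -> set Fn) Q u x : cube Q -> Q x -> avgK Q Phi u ->
  M_op Phi x u.
Proof. by move=> cQ Qx Qu; apply: subset_closure; exists Q. Qed.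

(** T f is a selection of M^K(K(f)): on a cube of the family its value is an
    average of f, and elsewhere it is 0, which belongs to every set of K. *)
Lemma MK_bound_T_bound c P : MK_bound X c -> cube_family P -> T_bound X P c.
Proof.
move=> [c0 XL MKc] [cP tP]; split => // f Xf.
have [XF nF] := XK_Ku Xf.
have [[_ [b bS]] MKF] := MKc _ XF.
have ST : S0 (MK_op (fun x => Ku (f x))) (T_op P f).
  split; first exact: L0_T_op.
  apply: aeW => x A [KA MA].
  have [[Q PQ Qx]|nP] := pselect ((\bigcup_(Q in P) Q) x).
    rewrite (T_op_in _ tP PQ)//; apply: MA.
    apply: M_op_avg (cP _ PQ) Qx _.
    by have [] := L1locK_Ku XL Xf (cP _ PQ).
  by rewrite T_op_out//; exact: Kset0.
have [XT _] := bS _ ST.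
split=> [Q PQ|//|]; first by have [] := L1locK_Ku XL Xf (cP _ PQ).
rewrite -lee_fin; apply: (@le_trans _ _ (XKnorm X (MK_op (fun x => Ku (f x))))).
  by apply: ereal_sup_ubound; exists (T_op P f).
by apply: le_trans MKF _; rewrite EFinM lee_wpmul2l// lee_fin.
Qed.

(** With u the average of f over Q, the set where u belongs to M(K(f)) contains
    Q, so that T f = 1_Q u is dominated by its indicator times u. *)
Lemma Mweak_bound_T_bound c Q : Mweak_bound X c -> cube Q -> T_bound X [set Q] c.
Proof.
move=> [c0 XL Mc] cQ; split=> [|f Xf]; first exact: ltW.
have [XF nF] := XK_Ku Xf; have [inX Mb] := Mc _ XF.
have [intf Qavg] := L1locK_Ku XL Xf cQ.
set u := avg Q f in Qavg.
have mQ := measurable_cube cQ.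
have [XT nT] : fcar X (T_op [set Q] f) /\ fnorm X (T_op [set Q] f) <=
    fnorm X (cutoff [set x | M_op (fun x => Ku (f x)) x u] (cst u)).
  rewrite T_op_set1; apply: (bfs_domT HX (inX u)).
    by apply: L0_cutoff => //; exact: L0_cst.
  move=> x; have [Qx|nQx] := pselect (Q x).
    rewrite !cutoff_in//; first exact: Ku_refl.
    exact: (M_op_avg cQ Qx Qavg).
  by rewrite (cutoff_out (cst u) nQx); exact: (Kset0 (Kset_Ku _)).
split=> [_ -> //|//|]; apply: le_trans nT _; rewrite -lee_fin.
apply: (@le_trans _ _ (c%:E * XKnorm X (fun x => Ku (f x)))%E).
  by apply: le_trans Mb; apply: ereal_sup_ubound; exists u.
by rewrite EFinM lee_wpmul2l// lee_fin ltW.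
Qed.

End implications.

(** * From single cubes to disjoint families *)

Section exhaustion.
Context (R : realType) (F : scalars) (d n : nat).
Local Notation Fn := 'rV[scal R F]_n.
Local Notation Rd := (Rd R d).
Local Notation mu := (Leb R d).
Implicit Types (f g : Rd -> Fn) (Q G E : set Rd) (P : set (set Rd)).

Lemma cube_contains_rational_box Q : cube Q ->
  exists q, rational_box R q `<=` Q /\ rational_box R q !=set0.
Proof.
move=> /cubeP[a [l [b [c [l0 ->]]]]].
pose x := [tuple tnth a i + l / 2 | i < d].
have [q [qx hq]] := @rational_box_neighborhood R d x (l / 2) (divr_gt0 l0 (ltr0Sn _ 1)).
exists q; split; last by exists x.
move=> y /hq hy i; have := hy i; rewrite tnth_mktuple ltr_norml => /andP[h1 h2].
have z1 : tnth a i < tnth y i by lra.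
have z2 : tnth y i < tnth a i + l by lra.
by rewrite in_itv /=; case: (b i); case: (c i) => /=; rewrite ?z1 ?z2 ?(ltW z1) ?(ltW z2).
Qed.

(** As the cubes are disjoint, a rational box inside a cube determines it. *)
Lemma cube_family_countable P : cube_family P -> countable P.
Proof.
move=> [cP tP]; apply/countable_injP.
have ex Q : exists q, cube Q -> rational_box R q `<=` Q /\ rational_box R q !=set0.
  have [/cube_contains_rational_box[q hq]|nQ] := pselect (cube Q); first by exists q.
  by exists ([tuple 0 | i < d], 0).
pose q Q := projT1 (cid (ex Q)).
have qP Q : cube Q -> rational_box R (q Q) `<=` Q /\ rational_box R (q Q) !=set0 :=
  projT2 (cid (ex Q)).
exists (fun Q => pickle (q Q)) => Q Q' /set_mem PQ /set_mem PQ' /(pcan_inj pickleK) qq.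
apply: tP => //.
have [qQ [x qx]] := qP Q (cP _ PQ); have [qQ' _] := qP Q' (cP _ PQ').
by exists x; split; [exact: qQ | apply: qQ'; rewrite -qq].
Qed.

Variable X : fspace R F d n.
Hypothesis HX : directional_BFS X.
Hypothesis refl_X : kothe_reflexive X.

(** An enumeration of P exhausts its union by an increasing sequence of finite
    unions. *)
Lemma fatou_cubes P f (c : R) : P `<=` @cube R d -> countable P -> L0 f -> 0 <= c ->
  (forall P', finite_set P' -> P' `<=` P ->
     fcar X (cutoff (\bigcup_(Q in P') Q) f) /\
     fnorm X (cutoff (\bigcup_(Q in P') Q) f) <= c) ->
  fcar X (cutoff (\bigcup_(Q in P) Q) f) /\
  fnorm X (cutoff (\bigcup_(Q in P) Q) f) <= c.
Proof.
move=> cP /countable_injP[i inji] mf c0 h.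
pose E k := \bigcup_(Q in [set Q | P Q /\ i Q = k]) Q.
have -> : \bigcup_(Q in P) Q = \bigcup_k E k.
  apply/seteqP; split=> x; first by move=> [Q PQ Qx]; exists (i Q) => //; exists Q.
  by move=> [k _ [Q [PQ _] Qx]]; exists Q.
apply: (fatou_property HX refl_X mf c0) => [k|N EN].
  by apply: measurable_bigcup_cube => Q [/cP].
have -> : EN = \bigcup_(Q in [set Q | P Q /\ (i Q < N)%N]) Q.
  apply/seteqP; split=> x.
    by move=> [k kN [Q [PQ ik] Qx]]; exists Q => //; split=> //; rewrite ik.
  by move=> [Q [PQ iN] Qx]; exists (i Q) => //; exists Q.
apply: h => [|Q []//].
have inj' : {in [set Q | P Q /\ (i Q < N)%N] &, injective i}.
  by move=> Q Q' /set_mem[PQ _] /set_mem[PQ' _]; apply: inji; exact: mem_set.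
rewrite -(eq_finite_set (inj_card_eq inj')).
by apply: (@sub_finite_set _ _ `I_N) => // _ [Q [_ QN] <-].
Qed.

Lemma dual_cutoff g Q : measurable Q -> fcar (kothe_dual X) g ->
  fcar (kothe_dual X) (cutoff Q g).
Proof.
move=> mQ [mg goo]; split; first exact: L0_cutoff.
apply: le_lt_trans goo; apply: ge_ereal_sup => _ [f [Xf f1] <-].
apply: (@le_trans _ _ (pairing f g)); last first.
  by apply: ereal_sup_ubound; exists f.
have mf := dbfs_L0 HX Xf.
have p0 (x : Rd) : setT x -> (0 <= (sabs (dot (f x) (cutoff Q g x)))%:E)%E.
  by rewrite lee_fin sabs_ge0.
apply: (ge0_le_integral mu measurableT p0
  (measurable_pairing mf (L0_cutoff mQ mg)) (measurable_pairing mf mg)).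
move=> x _; rewrite lee_fin; have [Qx|nQx] := pselect (Q x).
  by rewrite cutoff_in.
by rewrite (cutoff_out g nQx) sabs_dotC dot0l sabs0 sabs_ge0.
Qed.

Lemma T_op_cutoff P P' f : cube_family P -> P' `<=` P ->
  cutoff (\bigcup_(Q in P') Q) (T_op P f) = T_op P' f.
Proof.
move=> [cP tP] PP'; have tP' : trivIset P' id by apply: sub_trivIset tP.
apply/funext => x; have [[Q PQ Qx]|nU] := pselect ((\bigcup_(Q in P') Q) x).
  rewrite cutoff_in; last by exists Q.
  by rewrite (T_op_in _ tP' PQ)// (T_op_in _ tP (PP' _ PQ)).
by rewrite cutoff_out// T_op_out.
Qed.

Lemma dual_fnorm_ge0 g : 0 <= fnorm (kothe_dual X) g.
Proof.
rewrite /= /dual_norm; set S := (X in ereal_sup X).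
have [[e Se]|nS] := pselect (exists e, S e); last first.
  rewrite (_ : S = set0) ?ereal_sup0//.
  by apply/seteqP; split => // e Se; apply: nS; exists e.
apply: fine_ge0; apply: (@le_trans _ _ e); last exact: ereal_sup_ubound.
by case: Se => f _ <-; exact: pairing_ge0.
Qed.

Lemma pairing_sum_le (I : Type) (s : seq I) (f : I -> Rd -> Fn) (t : Rd -> Fn) g :
  L0 t -> (forall i, L0 (f i)) -> L0 g ->
  (forall x, sabs (dot (t x) (g x)) <= \sum_(i <- s) sabs (dot (f i x) (g x))) ->
  (pairing t g <= \sum_(i <- s) pairing (f i) g)%E.
Proof.
move=> mt mf mg h.
have p0 (x : Rd) : setT x -> (0 <= (sabs (dot (t x) (g x)))%:E)%E.
  by rewrite lee_fin sabs_ge0.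
have q0 i (x : Rd) : setT x -> (0 <= (sabs (dot (f i x) (g x)))%:E)%E.
  by rewrite lee_fin sabs_ge0.
have mq i := measurable_pairing (mf i) mg.
rewrite /pairing -(ge0_integral_sum mu measurableT mq q0).
apply: (ge0_le_integral mu measurableT p0 (measurable_pairing mt mg)
  (emeasurable_sum s mq)).
by move=> x _; rewrite sumEFin lee_fin.
Qed.

(** For g in X' of norm 1, split the pairing of T f with g over the cubes Q of the
    family.  On Q, T f is the average of 1_Q f, so the term is at most a times
    the norm of 1_Q f in X times the norm of 1_Q g in X'. *)
Lemma T_bound_finite P' (a C : R) : finite_set P' -> cube_family P' ->
  0 <= a -> (forall Q, cube Q -> T_bound X [set Q] a) -> cube_sum_bound X C ->
  0 <= C -> forall f, fcar X f ->
  fcar X (T_op P' f) /\ fnorm X (T_op P' f) <= C * a * fnorm X f.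
Proof.
move=> finP famP a0 bT sumC C0 f Xf; have [cP tP] := famP.
have mT : L0 (T_op P' f) := L0_T_op f famP.
apply: bidual_bound => //.
  by rewrite !mulr_ge0// (dbfs_norm_ge0 HX).
move=> g Yg g1; have mg := Yg.1.
have [s uniqs Ps] : exists2 s : seq (set Rd), uniq s & P' = [set` s].
  have /finite_seqP[s sE] := finP; exists (undup s); first exact: undup_uniq.
  by rewrite sE; apply/seteqP; split=> Q /=; rewrite mem_undup.
have sP Q : Q \in s -> P' Q by rewrite Ps.
pose t Q := if Q \in s then T_op [set Q] (cutoff Q f) else cst 0.
have cs Q : Q \in s -> cube Q by move=> /sP /cP.
have tE Q : Q \in s -> t Q = cutoff Q (cst (avg Q f)).
  by rewrite /t => ->; rewrite T_op_set1 avg_cutoff_self.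
have mt Q : L0 (t Q).
  rewrite /t; case: ifPn => [Qs|_]; last exact: L0_cst.
  by apply/L0_T_op/cube_family_set1/cs.
apply: (@le_trans _ _ (\sum_(Q <- s) pairing (t Q) g)%E).
  apply: pairing_sum_le => // x.
  have [[Q PQ Qx]|nU] := pselect ((\bigcup_(Q in P') Q) x); last first.
    by rewrite T_op_out// dot0l sabs0 sumr_ge0// => Q _; exact: sabs_ge0.
  have Qs : Q \in s by move: PQ; rewrite Ps.
  rewrite (T_op_in _ tP PQ)// (bigD1_seq Q)//= tE// cutoff_in// lerDl.
  by rewrite sumr_ge0// => Q' _; exact: sabs_ge0.
pose b Q := fnorm X (cutoff Q f) * fnorm (kothe_dual X) (cutoff Q g).
have b0 Q : Q \in s -> 0 <= b Q.
  move=> /cs/measurable_cube mQ; apply: mulr_ge0; last exact: dual_fnorm_ge0.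
  by apply: (dbfs_norm_ge0 HX); have [] := bfs_cutoff HX mQ Xf.
have bsum : ((\sum_(Q <- s) b Q)%:E <= (C * fnorm X f * fnorm (kothe_dual X) g)%:E)%E.
  apply: le_trans (sumC P' f g famP Xf Yg).
  rewrite -sumEFin fsbig_seq// -Ps esum_fset//.
  by move=> Q; rewrite inE Ps lee_fin /= => /b0.
rewrite g1 mulr1 in bsum.
apply: (@le_trans _ _ (a%:E * (\sum_(Q <- s) b Q)%:E)%E); last first.
  by rewrite mulrAC mulrC EFinM lee_wpmul2l// lee_fin.
rewrite -EFinM mulr_sumr -sumEFin !big_seq; apply: lee_sum => Q Qs.
have mQ := measurable_cube (cs _ Qs).
have [Xc _] := bfs_cutoff HX mQ Xf.
have [_ /(_ _ Xc)[_ XT nT]] := bT Q (cs _ Qs).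
have -> : pairing (t Q) g = pairing (t Q) (cutoff Q g).
  apply: eq_integral => x _; congr (sabs _)%:E.
  have [Qx|nQx] := pselect (Q x); first by rewrite cutoff_in.
  by rewrite tE// (cutoff_out (cst _) nQx) !dot0l.
have Xt : fcar X (t Q) by rewrite /t Qs.
apply: le_trans (holder HX Xt (dual_cutoff mQ Yg)) _.
rewrite lee_fin mulrA ler_wpM2r ?dual_fnorm_ge0//.
by rewrite /t Qs.
Qed.

Lemma T_bound_of_cube_sum P (a C : R) : cube_family P ->
  0 <= a -> (forall Q, cube Q -> T_bound X [set Q] a) -> cube_sum_bound X C ->
  0 <= C -> T_bound X P (C * a).
Proof.
move=> famP a0 bT sumC C0; have [cP tP] := famP.
split=> [|f Xf]; first exact: mulr_ge0.
have intf Q : P Q -> vintegrable Q f.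
  by move=> PQ; have [_ /(_ _ Xf)[/(_ Q erefl)]] := bT Q (cP _ PQ).
have Caf0 : 0 <= C * a * fnorm X f by rewrite !mulr_ge0// (dbfs_norm_ge0 HX).
have := fatou_cubes cP (cube_family_countable famP) (L0_T_op f famP) Caf0.
rewrite T_op_cutoff// => h; split=> //; apply h => P' finP' P'P.
  rewrite T_op_cutoff//.
  have famP' : cube_family P' by split; [exact: subset_trans cP | exact: sub_trivIset tP].
  by have [] := T_bound_finite finP' famP' a0 bT sumC C0 Xf.
rewrite T_op_cutoff//.
have famP' : cube_family P' by split; [exact: subset_trans cP | exact: sub_trivIset tP].
exact: (T_bound_finite finP' famP' a0 bT sumC C0 Xf).
Qed.

End exhaustion.

(** * Shifted grids *)

Section shifted_grids.
Context (R : realType) (d : nat).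
Local Notation Rd := (Rd R d).
Local Notation mu := (Leb R d).

(** In units of the side of a cell.  The grids of the line with shifts 0 and 1/3
    have no boundary points closer to each other than a third of their step. *)
Definition grid_shift (b : bool) : R := if b then 3^-1 else 0.

(** A cell of level k of the grid with shifts al, half-open so that the cells of a
    level form a partition. *)
Definition grid_cube (al : {ffun 'I_d -> bool}) (k : int) (m : d.-tuple int) : set Rd :=
  [set x : d.-tuple R | forall i,
     (tnth m i)%:~R <= tnth x i / 4 ^ k + grid_shift (al i) < (tnth m i)%:~R + 1].

Lemma pow4_gt0 (k : int) : 0 < (4 : R) ^ k.
Proof. exact: exprz_gt0. Qed.

Lemma grid_cubeE al k m : grid_cube al k m =
  box [tuple ((tnth m i)%:~R - grid_shift (al i)) * 4 ^ k | i < d] (4 ^ k)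
    (fun=> true) (fun=> true).
Proof.
have p := pow4_gt0 k.
have e (x : R) (j : int) b :
    (x \in `[(j%:~R - grid_shift b) * 4 ^ k,
             (j%:~R - grid_shift b) * 4 ^ k + 4 ^ k[) =
    (j%:~R <= x / 4 ^ k + grid_shift b < j%:~R + 1).
  have -> : (j%:~R - grid_shift b) * 4 ^ k + 4 ^ k = (j%:~R + 1 - grid_shift b) * 4 ^ k by ring.
  by rewrite in_itv /= -ler_pdivlMr// -ltr_pdivrMr// lerBlDr ltrBrDr.
by apply/seteqP; split=> x /= h i; have := h i; rewrite tnth_mktuple e.
Qed.

Lemma cube_grid_cube al k m : cube (grid_cube al k m).
Proof. by rewrite grid_cubeE; do 4 eexists; split; first exact: pow4_gt0. Qed.

Lemma Leb_grid_cube al k m : mu (grid_cube al k m) = ((4 ^ k) ^+ d)%:E.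
Proof. by rewrite grid_cubeE; apply: Leb_box; exact: pow4_gt0. Qed.

(** This is why the scales are powers of 4: shifted by 1/3, grids with steps 4^k
    and 4^(k+1) are still nested. *)
Lemma grid_shift_step b : exists s : int, 4 * grid_shift b = grid_shift b + s%:~R.
Proof. by case: b; [exists 1 | exists 0]; rewrite /grid_shift; lra. Qed.

(** Points are in the same cell if no integer separates their rescaled
    coordinates; in this form passing to the next level only multiplies the
    integer by 4 and translates it. *)
Lemma same_cell_step b (k : int) (x y : R) :
  (forall m : int, (m%:~R <= x / 4 ^ k + grid_shift b) =
                   (m%:~R <= y / 4 ^ k + grid_shift b)) ->
  forall m : int, (m%:~R <= x / 4 ^ (k + 1) + grid_shift b) =
                  (m%:~R <= y / 4 ^ (k + 1) + grid_shift b).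
Proof.
move=> h m; have [s sE] := grid_shift_step b.
have e (z : R) : (m%:~R <= z / 4 ^ (k + 1) + grid_shift b) =
                 ((4 * m - s)%:~R <= z / 4 ^ k + grid_shift b).
  have p := pow4_gt0 k.
  rewrite expfzDr// expr1z invfM mulrA intrB intrM (_ : 4%:~R = 4 :> R)//.
  by move: (z / 4 ^ k) => w; apply/idP/idP => ?; lra.
by rewrite !e.
Qed.

Lemma same_cell_coarsen b (k : int) (t : nat) (x y : R) :
  (forall m : int, (m%:~R <= x / 4 ^ k + grid_shift b) =
                   (m%:~R <= y / 4 ^ k + grid_shift b)) ->
  forall m : int, (m%:~R <= x / 4 ^ (k + t%:Z) + grid_shift b) =
                  (m%:~R <= y / 4 ^ (k + t%:Z) + grid_shift b).
Proof.
move=> h; elim: t => [|t IH]; first by rewrite addr0.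
have -> : k + t.+1%:Z = k + t%:Z + 1 by lia.
exact: same_cell_step.
Qed.

Lemma same_cell (m : int) (x y : R) : m%:~R <= x < m%:~R + 1 ->
  m%:~R <= y < m%:~R + 1 -> forall j : int, (j%:~R <= x) = (j%:~R <= y).
Proof.
move=> /andP[x1 x2] /andP[y1 y2] j; have [jm|mj] := leP j m.
  have jm' : j%:~R <= m%:~R :> R by rewrite ler_int.
  by rewrite (le_trans jm' x1) (le_trans jm' y1).
have mj' : m%:~R + 1 <= j%:~R :> R by rewrite -(intrD _ m 1) ler_int lezD1.
by rewrite !leNgt (lt_le_trans x2 mj') (lt_le_trans y2 mj').
Qed.

Lemma grid_cube_nested al k k' m m' : (k <= k')%R ->
  grid_cube al k m `&` grid_cube al k' m' !=set0 ->
  grid_cube al k m `<=` grid_cube al k' m'.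
Proof.
move=> kk' [z [zm zm']] y ym i.
have [t kE] : exists t : nat, k' = k + t%:Z.
  exists `|k' - k|%N; rewrite gez0_abs ?subr_ge0//; lia.
have same := same_cell (zm i) (ym i).
have := zm' i; rewrite kE => /andP[z1 z2].
rewrite -(same_cell_coarsen t same) z1 /= ltNge -[1]/(1%:~R) -intrD.
by rewrite -(same_cell_coarsen t same) intrD -ltNge.
Qed.

Lemma grid_cube_nested_or_disjoint al k k' m m' :
  grid_cube al k m `&` grid_cube al k' m' !=set0 ->
  grid_cube al k m `<=` grid_cube al k' m' \/ grid_cube al k' m' `<=` grid_cube al k m.
Proof.
move=> h; have [kk'|/ltW kk'] := leP k k'; first by left; exact: grid_cube_nested.
by right; apply: grid_cube_nested => //; rewrite setIC.
Qed.

Lemma pow4_scale (y : R) : 0 < y -> exists k : int, y <= 4 ^ k <= 4 * y.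
Proof.
have unb (z : R) : exists j : nat, z < 4 ^+ j.
  exists (Num.bound `|z|); apply: (@lt_le_trans _ _ (Num.bound `|z|)%:R).
    by apply: le_lt_trans (ler_norm z) _; apply: archi_boundP.
  elim: (Num.bound _) => [|j IH]; first by rewrite expr0.
  rewrite exprS -natr1; have : 1 <= 4 ^+ j :> R by rewrite exprn_ege1// ler1n.
  lra.
move=> y0; case: (ex_minnP (unb y^-1)) => i yi mini.
case: (ex_minnP (unb y)) => j yj minj.
have [y1|y1] := leP 1 y.
  case: j yj minj => [|j] yj minj; first by move: yj; rewrite expr0; lra.
  exists j.+1%:Z; rewrite -exprnP (ltW yj) /= exprS ler_pM2l//.
  by rewrite leNgt; apply/negP => /minj; rewrite ltnn.
have yi1 : 1 < y^-1 by rewrite invf_gt1.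
case: i yi mini => [|i] yi mini; first by move: yi; rewrite expr0; lra.
exists (- i%:Z); rewrite -invr_expz -exprnP; apply/andP; split.
  rewrite -[leLHS]invrK lef_pV2 ?posrE ?exprn_gt0 ?invr_gt0//.
  by rewrite leNgt; apply/negP => /mini; rewrite ltnn.
rewrite -ler_pdivrMl//.
rewrite -invfM -exprS -[leRHS]invrK lef_pV2 ?posrE ?exprn_gt0 ?invr_gt0//.
exact: ltW.
Qed.

(** In rescaled coordinates the interval lies in [A, A + 1/3], where
    m <= A < m + 1.  Either A + 1/3 < m + 1, or after the shift by 1/3 the interval
    lies between m + 1 and m + 2. *)
Lemma interval_in_cell (a l : R) (k : int) : 3 * l <= 4 ^ k ->
  exists b (m : int), forall x : R, a <= x <= a + l ->
    m%:~R <= x / 4 ^ k + grid_shift b < m%:~R + 1.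
Proof.
move=> lk; have p := pow4_gt0 k; pose A := a / 4 ^ k.
have xA x : a <= x <= a + l -> A <= x / 4 ^ k <= A + 3^-1.
  move=> /andP[x1 x2]; rewrite /A ler_pM2r ?invr_gt0// x1 /=.
  apply: (@le_trans _ _ ((a + l) / 4 ^ k)); first by rewrite ler_pM2r ?invr_gt0.
  by rewrite mulrDl lerD2l ler_pdivrMr//; lra.
pose m := Num.floor A.
have m1 : m%:~R <= A by exact: floor_le.
have m2 : A < m%:~R + 1 by rewrite -(intrD _ m 1) -floor_lt_int ltzD1.
have [h|h] := ltP (A + 3^-1) (m%:~R + 1).
  exists false, m => x /xA /andP[h1 h2]; rewrite /grid_shift; apply/andP; split; lra.
exists true, (m + 1) => x /xA /andP[h1 h2]; rewrite /grid_shift intrD /=.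
by apply/andP; split; lra.
Qed.

(** The grid is chosen coordinate by coordinate, at the scale 4^k between 3 l and
    12 l, where l is the side of Q. *)
Lemma cube_in_grid_cube (Q : set Rd) : cube Q -> exists al k m,
  Q `<=` grid_cube al k m /\ 12^-1 ^+ d <= fine (mu Q) / fine (mu (grid_cube al k m)).
Proof.
move=> /cubeP[a [l [b [c [l0 ->]]]]].
have [k /andP[k1 k2]] : exists k : int, 3 * l <= 4 ^ k <= 4 * (3 * l).
  by apply: pow4_scale; rewrite mulr_gt0.
have p := pow4_gt0 k.
have ex i := interval_in_cell (tnth a i) k1.
pose al := [ffun i => projT1 (cid (ex i))].
pose m := [tuple projT1 (cid (projT2 (cid (ex i)))) | i < d].
exists al, k, m; split.
  move=> x xQ i; rewrite /al /m ffunE tnth_mktuple.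
  apply: (projT2 (cid (projT2 (cid (ex i))))).
  have := xQ i; rewrite in_itv /=.
  by case: (b i); case: (c i) => /= /andP[h1 h2]; rewrite ?h1 ?h2 ?(ltW h1) ?(ltW h2).
rewrite Leb_grid_cube Leb_box// -expr_div_n.
rewrite lerXn2r ?nnegrE ?divr_ge0 ?invr_ge0 ?(ltW l0) ?(ltW p)//.
rewrite ler_pdivlMr//; lra.
Qed.

End shifted_grids.

(** * Selections and disjoint families *)

(** By induction: a new set contained in a selected one is discarded; otherwise it
    replaces the selected sets that it contains, and is disjoint from the others. *)
Lemma nested_disjoint_subfamily (T : Type) (s : seq (set T)) :
  (forall A B, A \in s -> B \in s -> A `&` B !=set0 -> A `<=` B \/ B `<=` A) ->
  exists s' : seq (set T), [/\ {subset s' <= s}, trivIset [set` s'] id &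
    \bigcup_(A in [set` s']) A = \bigcup_(A in [set` s]) A].
Proof.
elim: s => [_|A s IH h]; first by exists [::].
have [|s' [ss' ts' Us']] := IH.
  by move=> B C Bs Cs; apply: h; rewrite inE ?Bs ?Cs orbT.
have [[B Bs' AB]|nAB] := pselect (exists2 B, B \in s' & A `<=` B).
  exists s'; split=> //; first by move=> C /ss' Cs; rewrite inE Cs orbT.
  rewrite Us'; apply/seteqP; split=> x [C /= Cs Cx].
    by exists C => //=; rewrite inE Cs orbT.
  move: Cs; rewrite inE => /orP[/eqP CA|Cs]; last by exists C.
  have : (\bigcup_(D in [set` s']) D) x by exists B => //; apply: AB; rewrite -CA.
  by rewrite Us'.
pose s'' := A :: [seq B <- s' | ~~ `[<B `<=` A>]].
have s''P B : B \in s'' -> B = A \/ (B \in s' /\ ~ B `<=` A).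
  rewrite inE => /orP[/eqP->|]; first by left.
  by rewrite mem_filter => /andP[/asboolPn nBA Bs']; right.
have disjA B : B \in s' -> ~ B `<=` A -> ~ (A `&` B !=set0).
  move=> Bs' nBA AB; have As : A \in A :: s by exact: mem_head.
  have Bs : B \in A :: s by rewrite inE ss' ?orbT.
  by have [AB'|//] := h A B As Bs AB; apply: nAB; exists B.
exists s''; split.
- by move=> B /s''P[->|[/ss' Bs _]]; rewrite inE ?eqxx ?Bs ?orbT.
- move=> B C /= /s''P[->|[Bs nB]] /s''P[->|[Cs nC]] BC //.
  + by case: (disjA C).
  + by rewrite setIC in BC; case: (disjA B).
  + exact: ts'.
- apply/seteqP; split=> x [B /= Bs Bx].
    have [BA|[/ss' Bs' _]] := s''P B Bs; first by exists A; rewrite /= ?inE ?eqxx// -BA.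
    by exists B => //=; rewrite inE Bs' orbT.
  move: Bs; rewrite inE => /orP[/eqP BA|Bs].
    by exists A; rewrite /= ?inE ?eqxx// -BA.
  have : (\bigcup_(D in [set` s']) D) x by rewrite Us'; exists B.
  move=> [C /= Cs' Cx]; have [CA|nCA] := pselect (C `<=` A).
    by exists A; rewrite /= ?inE ?eqxx//; exact: CA.
  exists C => //=; rewrite inE mem_filter Cs'.
  by apply/orP; right; rewrite andbT; apply/asboolPn.
Qed.

Section weak_type.
Context (R : realType) (F : scalars) (d n : nat).
Local Notation Fn := 'rV[scal R F]_n.
Local Notation Rd := (Rd R d).
Local Notation mu := (Leb R d).
Implicit Types (f g : Rd -> Fn) (Q G E : set Rd) (P : set (set Rd)) (u v : Fn).
Variable X : fspace R F d n.
Hypothesis HX : directional_BFS X.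
Hypothesis cubeX : has_cube_indicators X.

(** The integral of |f_k| over Q is the pairing of f with 1_Q e_k. *)
Lemma XK_L1locK : XK X `<=` @L1locK R F d n.
Proof.
move=> Phi [LP [b Sb]]; split => // Q cQ; have mQ := measurable_cube cQ.
pose D := \sum_(k < n) fnorm (kothe_dual X) (cutoff Q (cst (delta_mx 0 k))).
have D0 : 0 <= D by rewrite sumr_ge0// => k _; exact: dual_fnorm_ge0.
exists (`|b| * D) => f Sf; have mf := Sf.1.
have [Xf fb] := Sb f (S0_cutoffK_sub (fun x => LP.1 x) Sf).
have m1 k : measurable_fun [set: Rd] (fun x => (sabs (f x 0 k))%:E).
  by apply/measurable_EFinP/measurable_sabs/L0_coord.
have p0 k (x : Rd) : setT x -> (0 <= (sabs (f x 0 k))%:E)%E.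
  by rewrite lee_fin sabs_ge0.
have v0 (x : Rd) : setT x -> (0 <= (vabs (f x))%:E)%E by rewrite lee_fin vabs_ge0.
have mv : measurable_fun [set: Rd] (fun x => (vabs (f x))%:E).
  by apply/measurable_EFinP/measurable_vabs.
apply: (@le_trans _ _ (\int[mu]_x (\sum_(k < n) (sabs (f x 0 k))%:E))%E).
  apply: (ge0_le_integral mu measurableT v0 mv (emeasurable_sum _ m1)).
  by move=> x _; rewrite sumEFin lee_fin vabs_le_sum.
rewrite (ge0_integral_sum mu measurableT m1 p0) /D mulr_sumr -sumEFin.
apply: lee_sum => k _.
have Qk := (cubeX (delta_mx 0 k) cQ).2.
have mp : measurable_fun [set: Rd]
    (fun x => (sabs (dot (f x) (cutoff Q (cst (delta_mx 0 k)) x)))%:E).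
  by apply: measurable_pairing => //; exact: Qk.1.
have q0 (x : Rd) : setT x ->
    (0 <= (sabs (dot (f x) (cutoff Q (cst (delta_mx 0 k)) x)))%:E)%E.
  by rewrite lee_fin sabs_ge0.
apply: (@le_trans _ _ (pairing f (cutoff Q (cst (delta_mx 0 k))))).
  apply: (ae_ge0_le_integral measurableT (p0 k) (m1 k) q0 mp).
  apply: filterS Sf.2 => x fx _; rewrite lee_fin sabs_dotC.
  have [Qx|nQx] := pselect (Q x).
    by rewrite cutoff_in// sabs_dotC dot_delta.
  by move: fx; rewrite /cutoffK memNset// => ->; rewrite mxE sabs0 sabs_ge0.
apply: le_trans (holder HX Xf Qk) _; rewrite lee_fin ler_wpM2r ?dual_fnorm_ge0//.
by rewrite (le_trans fb)// ler_norm.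
Qed.

(** A function that is small in the sup norm is decomposed along the standard
    basis, since the ideal property compares parallel vectors only. *)
Lemma small_error_bound (G : set Rd) (r : Rd -> Fn) (t : R) : 0 <= t -> L0 r ->
  (forall k, fcar X (cutoff G (cst (delta_mx 0 k)))) ->
  (forall x k, sabs (r x 0 k) <= t) -> (forall x, ~ G x -> r x = 0) ->
  fcar X r /\ fnorm X r <= t * \sum_(k < n) fnorm X (cutoff G (cst (delta_mx 0 k))).
Proof.
move=> t0 mr XG rt rG.
pose rk k x : Fn := r x 0 k *: delta_mx 0 k.
have hk k : fcar X (rk k) /\ fnorm X (rk k) <= t * fnorm X (cutoff G (cst (delta_mx 0 k))).
  have Xt := dbfs_scale HX (sr t) (XG k).
  have := dbfs_normZ HX (sr t) (XG k); rewrite sabs_sr ger0_norm// => <-.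
  have mrk : L0 (rk k) := L0_scale (L0_coord k mr) (@L0_cst R F d n (delta_mx 0 k)).
  apply: (bfs_domT HX Xt mrk).
  move=> x; have [Gx|nGx] := pselect (G x); last first.
    by rewrite /rk rG// mxE scale0r; exact: (Kset0 (Kset_Ku _)).
  rewrite cutoff_in// /rk /cst; have [tz|tz] := eqVneq t 0.
    have -> : r x 0 k = 0.
      by apply: sabs_eq0; apply/eqP; rewrite eq_le sabs_ge0 andbT; have := rt x k; rewrite tz.
    by rewrite scale0r; exact: (Kset0 (Kset_Ku _)).
  apply/KuP; exists (sr t^-1 * r x 0 k).
    rewrite sabsM sabs_sr ger0_norm ?invr_ge0// mulrC ler_pdivrMr ?mul1r//.
    by rewrite lt_def tz.
  by rewrite scalerA mulrAC -srM mulVf// sr1 mul1r.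
have [h1 h2] := bfs_sum HX (index_enum 'I_n) (f := rk) (fun k => (hk k).1).
have rE : (fun x => \sum_(k < n) rk k x) = r.
  by apply/funext => x; rewrite [RHS]row_sum_delta.
rewrite rE in h1 h2; split => //; apply: le_trans h2 _.
by rewrite mulr_sumr; apply: ler_sum => k _; exact: (hk k).2.
Qed.

Lemma cutoff_setC Q f x : Q x -> cutoff (~` Q) f x = 0.
Proof. by move=> Qx; apply: cutoff_out => /=; exact. Qed.

Lemma glue_selections (Phi : Rd -> set Fn) (s : seq (set Rd)) (f : set Rd -> Rd -> Fn) :
  (forall x, Kset (Phi x)) -> trivIset [set` s] id ->
  (forall Q, Q \in s -> measurable Q /\ S0 (cutoffK Q Phi) (f Q)) ->
  exists2 g, S0 Phi g & forall Q, Q \in s -> forall x, Q x -> g x = f Q x.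
Proof.
move=> KP; elim: s => [_ _|Q s IH ts hs].
  exists (cst 0); last by [].
  by split; [exact: L0_cst | apply: aeW => x; exact: Kset0].
have [|Q' Q's|g [mg gP] gE] := IH.
- by apply: sub_trivIset ts => Q' /= Q's; rewrite inE Q's orbT.
- by apply: hs; rewrite inE Q's orbT.
have [mQ [mfQ fQP]] := hs Q (mem_head _ _).
exists (cutoff Q (f Q) \+ cutoff (~` Q) g).
  split; first by apply: L0_add; apply: L0_cutoff => //; exact: measurableC.
  apply: filterS2 fQP gP => x fx gx; have [Qx|nQx] := pselect (Q x).
    rewrite /= cutoff_in// cutoff_setC// addr0.
    by move: fx; rewrite /cutoffK mem_set.
  by rewrite /= (cutoff_out _ nQx) add0r cutoff_in.
move=> Q'; rewrite inE => /orP[/eqP->|Q's] x Q'x /=.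
  by rewrite cutoff_in// cutoff_setC// addr0.
have [Qx|nQx] := pselect (Q x).
  rewrite cutoff_in// cutoff_setC// addr0.
  by rewrite (ts Q Q') //= ?inE ?eqxx ?Q's ?orbT//; exists x.
by rewrite (cutoff_out _ nQx) add0r cutoff_in// (gE Q').
Qed.

Lemma norm_cutoff_bigU (I : Type) (s : seq I) (H : I -> set Rd) f (b : R) :
  L0 f -> 0 <= b ->
  (forall i, measurable (H i)) ->
  (forall i, fcar X (cutoff (H i) f) /\ fnorm X (cutoff (H i) f) <= b) ->
  let U := \big[setU/set0]_(i <- s) H i in
  fcar X (cutoff U f) /\ fnorm X (cutoff U f) <= (size s)%:R * b.
Proof.
move=> mf b0 mH hH /=; elim: s => [|i s [IH1 IH2]].
  rewrite big_nil mul0r (_ : cutoff set0 f = cst 0).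
    by rewrite (bfs_norm0 HX); split => //; exact: (dbfs_zero HX).
  by apply/funext => x; rewrite cutoff_out.
rewrite big_cons; set U := \big[setU/set0]_(j <- s) H j in IH1 IH2 *.
have mU : measurable U by apply: bigsetU_measurable => j _.
have [hi1 hi2] := hH i.
have [D1 D2] := bfs_cutoff HX (measurableC (mH i)) IH1.
have -> : cutoff (H i `|` U) f = cutoff (H i) f \+ cutoff (~` H i) (cutoff U f).
  apply/funext => x /=; have [Hx|nHx] := pselect (H i x).
    rewrite (cutoff_in f Hx) cutoff_setC// addr0 cutoff_in//; exact: or_introl Hx.
  rewrite (cutoff_out f nHx) add0r [in RHS]cutoff_in//.
  have [Ux|nUx] := pselect (U x); first by rewrite !cutoff_in//; right.
  by rewrite !cutoff_out// => -[].
split; first exact: (dbfs_add HX).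
apply: le_trans (dbfs_normD HX hi1 D1) _.
by rewrite /= -natr1 mulrDl mul1r addrC lerD// (le_trans D2).
Qed.

End weak_type.

(** * The weak-type estimate *)

Section weak_type_estimate.
Context (R : realType) (F : scalars) (d n : nat).
Local Notation K := (scal R F).
Local Notation Fn := 'rV[scal R F]_n.
Local Notation Rd := (Rd R d).
Local Notation mu := (Leb R d).
Implicit Types (f g : Rd -> Fn) (Q G E : set Rd) (P : set (set Rd)) (u v : Fn).
Variable X : fspace R F d n.
Hypothesis HX : directional_BFS X.
Hypothesis refl_X : kothe_reflexive X.
Hypothesis cubeX : has_cube_indicators X.
Variables (A : R) (Phi : Rd -> set Fn) (M : R) (u : Fn).
Hypothesis A0 : 0 <= A.
Hypothesis bT : forall P, cube_family P -> T_bound X P A.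
Hypothesis XPhi : XK X Phi.
Hypothesis PhiM : forall f, S0 Phi f -> fcar X f /\ fnorm X f <= M.

Let KPhi x : Kset (Phi x) := XPhi.1.1 x.

(** A lower bound for the ratio between the volumes of a cube and of the cell that
    contains it; see [cube_in_grid_cube]. *)
Definition grid_ratio : R := 12^-1 ^+ d.
Let c := grid_ratio.

Lemma grid_ratio_gt0 : 0 < c.
Proof. by rewrite exprn_gt0// invr_gt0. Qed.

Let c0 := grid_ratio_gt0.
Let w : Fn := sr c *: u.

(** The cells over which some selection of Phi has an average close to a fixed
    multiple of u; using the same multiple for all cells makes the averages
    almost constant. *)
Definition good_grid_cubes (al : {ffun 'I_d -> bool}) (e : R) : set (set Rd) :=
  [set Q | (exists k m, Q = grid_cube al k m) /\
           exists2 v, avgK Q Phi v & row_close (c * e) w v].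

Lemma good_grid_cube_cube al e : good_grid_cubes al e `<=` @cube R d.
Proof. by move=> _ [[k [m ->]] _]; exact: cube_grid_cube. Qed.

Lemma good_grid_cubes_countable al e : countable (good_grid_cubes al e).
Proof.
apply: (@sub_countable _ _ _
  (range (fun km : int * d.-tuple int => grid_cube al km.1 km.2 : set Rd))).
  by apply: subset_card_le => _ [[k [m ->]] _]; exists (k, m).
by apply: (sub_countable (card_image_le _ _)); exact: countableP.
Qed.

Lemma M_op_row_close x e : M_op Phi x u -> 0 < e ->
  exists Q v, [/\ cube Q, Q x, avgK Q Phi v & row_close e u v].
Proof.
move=> /closure_rowP h /h[v [Q [cQ Qx] Qv] uv].
by exists Q, v.
Qed.

(** The selection on Q, extended by 0, has over the larger cell an average r v with
    r >= c; it is multiplied by c / r, which keeps it a selection because the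
    sets Phi x are convex and contain 0. *)
Lemma good_grid_cube_of_average Q al k m v e : cube Q -> avgK Q Phi v -> row_close e u v ->
  Q `<=` grid_cube al k m -> c <= fine (mu Q) / fine (mu (grid_cube al k m)) ->
  good_grid_cubes al e (grid_cube al k m).
Proof.
move=> cQ [f Sf <-] uv QQ' cr; split; first by exists k, m.
set Q' := grid_cube al k m in QQ' cr *; set r := _ / _ in cr.
have cQ' : cube Q' by exact: cube_grid_cube.
have mQ := measurable_cube cQ; have mQ' := measurable_cube cQ'.
have r0 : 0 < r by exact: lt_le_trans cr.
pose t := c / r.
have t01 : 0 <= t <= 1.
  by rewrite /t divr_ge0 ?(ltW c0) ?(ltW r0)//= ler_pdivrMr// mul1r.
have SQ' (z : R) : 0 <= z <= 1 -> S0 (cutoffK Q' Phi) (fun x => sr z *: cutoff Q f x).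
  move=> z01; split.
    by apply: (L0_scale (measurable_scal_cst d (sr z : K)) (L0_cutoff mQ Sf.1)).
  apply: filterS Sf.2 => x; rewrite /cutoffK; have [Qx|nQx] := pselect (Q x).
    rewrite mem_set// mem_set; last exact: QQ'.
    by rewrite cutoff_in// => fx; exact: Kset_shrink.
  rewrite (cutoff_out _ nQx) scaler0 => _; case: ifP => // _; exact: Kset0.
exists (sr c *: avg Q f); last first.
  move=> k'; rewrite /w [X in X - _]mxE [X in _ - X]mxE -mulrBr.
  by rewrite sabsM sabs_sr gtr0_norm// ltr_pM2l.
exists (fun x => sr t *: cutoff Q f x); first exact: SQ'.
have S1 := SQ' 1; rewrite ler01 lexx in S1.
have int1 : vintegrable Q' (cutoff Q f).
  have := L1locK_vintegrable (XK_L1locK HX cubeX XPhi) cQ' (S1 isT).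
  by apply: vintegrable_eq => // x _; rewrite sr1 scale1r.
rewrite (avg_scale t mQ' (L0_cutoff mQ Sf.1) int1) avg_cutoff// -/r.
by rewrite scalerA -srM /t divfK// gt_eqF.
Qed.

Let wB B := cutoff B (cst w : Rd -> Fn).
Let D B := \sum_(k < n) fnorm X (cutoff B (cst (delta_mx 0 k))).

(** With g the glued selection on a disjoint subfamily with the same union, the
    function to be estimated is 1_B T g, whose norm is at most A M, plus an error
    with coordinates at most c e on B. *)
Lemma finite_good_family_bound al e B P' : 0 < e -> cube B -> finite_set P' ->
  P' `<=` good_grid_cubes al e ->
  fcar X (cutoff (\bigcup_(Q in P') Q) (wB B)) /\
  fnorm X (cutoff (\bigcup_(Q in P') Q) (wB B)) <= A * M + c * e * D B.
Proof.
move=> e0 cB /finite_seqP[s sE] goodP.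
have mB := measurable_cube cB.
have goods Q : Q \in s -> good_grid_cubes al e Q by move=> Qs; apply: goodP; rewrite sE.
have [|s' [ss' ts' Us']] := @nested_disjoint_subfamily Rd s.
  move=> Q Q' /goods[[k [m ->]] _] /goods[[k' [m' ->]] _].
  exact: grid_cube_nested_or_disjoint.
rewrite sE -Us'.
have fam : cube_family [set` s'].
  by split => // Q /= /ss' /goods; exact: good_grid_cube_cube.
have [cs' _] := fam.
have exf Q : exists f, Q \in s' -> S0 (cutoffK Q Phi) f /\ row_close (c * e) w (avg Q f).
  have [/ss'/goods[_ [_ [f Sf <-] wf]]|] := boolP (Q \in s'); last by exists (cst 0).
  by exists f.
pose f Q := projT1 (cid (exf Q)).
have fP Q : Q \in s' ->
    S0 (cutoffK Q Phi) (f Q) /\ row_close (c * e) w (avg Q (f Q)) :=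
  projT2 (cid (exf Q)).
have [g Sg gE] : exists2 g, S0 Phi g & forall Q, Q \in s' -> forall x, Q x -> g x = f Q x.
  apply: glue_selections => // Q Qs'; split; last by have [] := fP Q Qs'.
  by apply: measurable_cube; exact: cs'.
have [Xg gM] := PhiM Sg.
have [_ /(_ g Xg)[_ XT nT]] := bT fam.
set U := \bigcup_(Q in _) Q.
have mU : measurable U by exact: measurable_bigcup_cube.
have [Xt nt] := bfs_cutoff HX mB XT.
set t := cutoff B (T_op _ g) in Xt nt.
have mt : L0 t := dbfs_L0 HX Xt.
pose W := cutoff U (wB B).
have mW : L0 W by apply: L0_cutoff => //; apply: L0_cutoff => //; exact: L0_cst.
pose r := W \+ (fun x => (-1 : K) *: t x).
have mr : L0 r := L0_add mW (L0_scale (measurable_scal_cst d (-1 : K)) mt).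
have ce0 : 0 <= c * e by rewrite mulr_ge0// ltW.
have XB k : fcar X (cutoff B (cst (delta_mx 0 k))) := (cubeX _ cB).1.
have rB x : ~ B x -> r x = 0.
  move=> nBx; rewrite /r /= /t (cutoff_out _ nBx) scaler0 addr0.
  by rewrite /W {1}/cutoff /wB (cutoff_out _ nBx) scaler0.
have rs x k : sabs (r x 0 k) <= c * e.
  have [Bx|nBx] := pselect (B x); last by rewrite rB// mxE sabs0.
  rewrite /r /W /t /wB /= scaleN1r (cutoff_in _ Bx).
  have [[Q Qs' Qx]|nUx] := pselect (U x); last first.
    by rewrite (cutoff_out _ nUx) T_op_out// subr0 mxE sabs0.
  rewrite (T_op_in _ ts' Qs' Qx) cutoff_in; last by exists Q.
  rewrite cutoff_in// (@avg_eq _ _ _ _ Q g (f Q)); last exact: gE.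
  by have [_ /(_ k)/ltW] := fP Q Qs'; rewrite !mxE -sabsN opprB.
have [Xr nr] := small_error_bound HX ce0 mr XB rs rB.
have WE : cutoff U (wB B) = t \+ r.
  by apply/funext => x; rewrite /r /= scaleN1r addrC subrK.
rewrite WE.
split; first exact: (dbfs_add HX).
apply: le_trans (dbfs_normD HX Xt Xr) _; apply: lerD nr.
by rewrite (le_trans nt)// (le_trans nT)// ler_wpM2l.
Qed.

Let E := [set x | M_op Phi x u].

(** For each j, the points that lie in a cube over which some selection averages to
    within 1/(j + 1) of u form a union of cubes. *)
Lemma measurable_M_op : measurable E.
Proof.
pose U (j : nat) := \bigcup_(Q in
  [set Q | cube Q /\ exists2 v, avgK Q Phi v & row_close (j.+1%:R^-1) u v]) Q.
rewrite (_ : E = \bigcap_j U j).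
  by apply: bigcapT_measurable => j; apply: measurable_bigcup_cube => Q [].
apply/seteqP; split=> x.
  move=> Ex j _; have j0 : 0 < j.+1%:R^-1 :> R by rewrite invr_gt0.
  by have [Q [v [cQ Qx Qv uv]]] := M_op_row_close Ex j0; exists Q => //; split => //; exists v.
move=> h; apply/closure_rowP => e e0.
have [Q [cQ [v Qv uv]] Qx] := h (Num.bound e^-1) I.
exists v; first by exists Q.
move=> k; apply: lt_le_trans (uv k) _.
rewrite -[leRHS]invrK lef_pV2 ?posrE ?invr_gt0//.
apply: (@le_trans _ _ (Num.bound e^-1)%:R); last by rewrite ler_nat.
by apply/ltW/archi_boundP; rewrite invr_ge0 ltW.
Qed.

Lemma selection_bound_ge0 : 0 <= M.
Proof.
have S : S0 Phi (cst 0) by split; [exact: L0_cst | apply: aeW => x; exact: Kset0].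
by have [_] := PhiM S; rewrite (bfs_norm0 HX).
Qed.

(** Sum the estimates over the 2^d grids, then let e tend to 0; the indicator of B
    is what makes the error term finite. *)
Lemma local_M_op_level_bound B : cube B ->
  fcar X (cutoff E (wB B)) /\ fnorm X (cutoff E (wB B)) <= 2 ^+ d * (A * M).
Proof.
move=> cB; have mB := measurable_cube cB; have mE := measurable_M_op.
have mwB : L0 (wB B) by apply: L0_cutoff => //; exact: L0_cst.
have D0 : 0 <= D B.
  by apply: sumr_ge0 => k _; apply: (dbfs_norm_ge0 HX); exact: (cubeX _ cB).1.
have step e : 0 < e -> fcar X (cutoff E (wB B)) /\
    fnorm X (cutoff E (wB B)) <= 2 ^+ d * (A * M + c * e * D B).
  move=> e0.
  have b0 : 0 <= A * M + c * e * D B.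
    by rewrite addr_ge0// ?mulr_ge0 ?selection_bound_ge0 ?(ltW e0) ?(ltW c0).
  pose H al := \bigcup_(Q in good_grid_cubes al e) Q.
  have mH al : measurable (H al).
    by apply: measurable_bigcup_cube; exact: good_grid_cube_cube.
  have hH al : fcar X (cutoff (H al) (wB B)) /\
      fnorm X (cutoff (H al) (wB B)) <= A * M + c * e * D B.
    apply: (fatou_cubes HX refl_X (@good_grid_cube_cube al e)
      (good_grid_cubes_countable al e) mwB b0).
    by move=> P' finP' P'g; exact: finite_good_family_bound finP' P'g.
  have [XU nU] := norm_cutoff_bigU HX (enum {ffun 'I_d -> bool}) mwB b0 mH hH.
  have EU x : E x -> (\big[setU/set0]_(al <- enum {ffun 'I_d -> bool}) H al) x.
    move=> Ex; have [Q [v [cQ Qx Qv uv]]] := M_op_row_close Ex e0.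
    have [al [k [m [QQ' cr]]]] := cube_in_grid_cube cQ.
    rewrite -bigcup_seq; exists al; first by rewrite /= mem_enum.
    exists (grid_cube al k m); last exact: QQ'.
    exact: (good_grid_cube_of_average cQ Qv uv QQ' cr).
  have [XE nE] : fcar X (cutoff E (wB B)) /\ fnorm X (cutoff E (wB B)) <=
      fnorm X (cutoff (\big[setU/set0]_(al <- enum {ffun 'I_d -> bool}) H al) (wB B)).
    apply: (bfs_domT HX XU); first exact: L0_cutoff.
    move=> x; have [Ex|nEx] := pselect (E x).
      by rewrite (cutoff_in _ Ex) (cutoff_in _ (EU x Ex)); exact: Ku_refl.
    by rewrite (cutoff_out _ nEx); exact: (Kset0 (Kset_Ku _)).
  split=> //; apply: le_trans nE _; apply: le_trans nU _.
  rewrite -cardE card_ffun card_bool card_ord natrX.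
  exact: lexx.
split; first by have [] := step 1 ltr01.
apply: (@le_of_eps _ _ _ (2 ^+ d * (c * D B))).
  by rewrite !mulr_ge0 ?exprn_ge0// ltW.
move=> e /step[_ /le_trans]; apply; rewrite mulrDr lerD2l.
by rewrite le_eqVlt; apply/orP; left; apply/eqP; ring.
Qed.

(** The bound of [local_M_op_level_bound] does not depend on B, so B may be
    exhausted by larger and larger cubes; 24 = 2 * 12 collects the number of
    grids and the ratio of volumes. *)
Lemma M_op_level_bound : fcar X (cutoff E (cst u)) /\
  fnorm X (cutoff E (cst u)) <= 24 ^+ d * A * M.
Proof.
have mE := measurable_M_op.
pose B (m : nat) : set Rd := box [tuple (- m.+1%:R : R) | i < d] (m.+1%:R *+ 2)
   (fun=> true) (fun=> true).
have BP m x : B m x <-> forall i, - m.+1%:R <= tnth x i < m.+1%:R.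
  rewrite /B; split=> h i; have := h i; rewrite tnth_mktuple in_itv /=.
    by rewrite (_ : - m.+1%:R + m.+1%:R *+ 2 = m.+1%:R :> R)//; ring.
  by rewrite (_ : - m.+1%:R + m.+1%:R *+ 2 = m.+1%:R :> R)//; ring.
have cB m : cube (B m).
  by do 4 eexists; split; last reflexivity; rewrite pmulrn_lgt0.
have Bmono m m' : (m <= m')%N -> B m `<=` B m'.
  move=> mm' x /BP h; apply/BP => i; have /andP[h1 h2] := h i.
  have mm : m.+1%:R <= m'.+1%:R :> R by rewrite ler_nat.
  by apply/andP; split; [rewrite (le_trans _ h1)// lerN2 | exact: lt_le_trans mm].
have BT : \bigcup_m B m = setT.
  apply/seteqP; split=> // x _.
  pose m := \max_(i < d) Num.bound `|tnth x i|.
  exists m => //; apply/BP => i.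
  have : `|tnth x i| < m.+1%:R.
    apply: (@lt_le_trans _ _ (Num.bound `|tnth x i|)%:R); first by apply: archi_boundP.
    by rewrite ler_nat (leq_trans _ (leqnSn _))// /m; exact: leq_bigmax.
  by rewrite ltr_norml => /andP[/ltW -> ->].
have mw : L0 (cutoff E (cst w : Rd -> Fn)) by apply: L0_cutoff => //; exact: L0_cst.
have b0 : 0 <= 2 ^+ d * (A * M) by rewrite !mulr_ge0 ?exprn_ge0 ?selection_bound_ge0.
have [] := fatou_property HX refl_X (E := B) mw b0.
- by move=> k; exact: measurable_cube.
- move=> N; set BN := \bigcup_(k in _) B k.
  have [XEB nEB] := local_M_op_level_bound (cB N).
  have mBN : measurable BN.
    by apply: bigcup_measurable => k _; exact: measurable_cube.
  have [XX nX] : fcar X (cutoff BN (cutoff E (cst w))) /\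
     fnorm X (cutoff BN (cutoff E (cst w))) <= fnorm X (cutoff E (wB (B N))).
    apply: (bfs_domT HX XEB); first exact: L0_cutoff.
    move=> x; have [[k kN Bkx]|nBx] := pselect (BN x); last first.
      by rewrite (cutoff_out _ nBx); exact: (Kset0 (Kset_Ku _)).
    rewrite [X in Ku _ X]cutoff_in; last by exists k.
    have [Ex|nEx] := pselect (E x); last by rewrite !(cutoff_out _ nEx); exact: Ku_refl.
    rewrite !(cutoff_in _ Ex) /wB cutoff_in; first exact: Ku_refl.
    by apply: Bmono Bkx; exact: ltnW.
  by split=> //; exact: le_trans nX nEB.
rewrite BT => XE nE.
have wE : cutoff setT (cutoff E (cst w)) = cutoff E (cst w).
  by apply/funext => x; rewrite cutoff_in.
rewrite wE in XE nE.
have uE : cutoff E (cst u) = (fun x => sr c^-1 *: cutoff E (cst w) x).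
  apply/funext => x; rewrite /cutoff /cst /w scalerA mulrC -scalerA; congr (_ *: _).
  by rewrite scalerA -srM mulVf ?gt_eqF// sr1 scale1r.
rewrite uE (dbfs_normZ HX)// sabs_sr gtr0_norm ?invr_gt0//; split.
  exact: (dbfs_scale HX).
apply: (@le_trans _ _ (c^-1 * (2 ^+ d * (A * M)))).
  by rewrite ler_pM2l// invr_gt0.
have -> : c^-1 = 12 ^+ d by rewrite /c /grid_ratio exprVn invrK.
by rewrite !mulrA -exprMn -natrM.
Qed.

End weak_type_estimate.

(** * Comparison of the constants *)

Section comparison.
Context (R : realType) (F : scalars) (d n : nat).
Local Notation Fn := 'rV[scal R F]_n.
Local Notation Rd := (Rd R d).
Variable X : fspace R F d n.
Hypothesis HX : directional_BFS X.

Lemma XKnorm_bound (Phi : Rd -> set Fn) : XK X Phi ->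
  XKnorm X Phi \is a fin_num /\
  forall f, S0 Phi f -> fcar X f /\ fnorm X f <= fine (XKnorm X Phi).
Proof.
move=> XPhi; have [LP [b Sb]] := XPhi.
have KP x : Kset (Phi x) := LP.1 x.
have S0f : S0 Phi (cst 0) by split; [exact: L0_cst | apply: aeW => x; exact: Kset0].
have fin : XKnorm X Phi \is a fin_num.
  rewrite ge0_fin_numE.
    apply: le_lt_trans (ltry b); apply: ge_ereal_sup => _ [f /Sb[_ fb] <-].
    by rewrite lee_fin.
  by apply: ereal_sup_ubound; exists (cst 0) => //; rewrite (bfs_norm0 HX).
split=> // f Sf; have [Xf _] := Sb f Sf; split => //.
by rewrite -lee_fin fineK//; apply: ereal_sup_ubound; exists f.
Qed.

Lemma Mweak_bound_of_T_bound (A c : R) : kothe_reflexive X -> has_cube_indicators X ->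
  0 <= A -> (forall P, cube_family P -> T_bound X P A) ->
  0 < c -> 24 ^+ d * A <= c -> Mweak_bound X c.
Proof.
move=> refl_X cubeX A0 bT c0 Ac; split=> //; first exact: XK_L1locK.
move=> Phi XPhi; have [fin PhiM] := XKnorm_bound XPhi.
have M0 := selection_bound_ge0 HX XPhi PhiM.
have bound u := M_op_level_bound HX refl_X cubeX u A0 bT XPhi PhiM.
split=> [u|]; first by have [] := bound u.
apply: ge_ereal_sup => _ [u _ <-]; rewrite -(fineK fin) -EFinM lee_fin.
have [_ /le_trans] := bound u; apply.
by rewrite ler_wpM2r.
Qed.

Lemma has_cube_indicators_of_A_const : saturated X -> saturated (kothe_dual X) ->
  (A_const X < +oo)%E -> has_cube_indicators X.
Proof.
move=> satX satX' Aoo.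
have fin : A_const X \is a fin_num by rewrite ge0_fin_numE// A_const_ge0.
apply: (cube_indicators_of_T_bound HX satX satX' (fine_ge0 (A_const_ge0 X))).
by apply: (A_const_bound HX); rewrite fineK.
Qed.

Lemma Astrong_le_MK_norm : (Astrong_const X <= MK_norm X)%E.
Proof.
apply: le_ereal_inf_tmp => _ [c bc <-]; apply: ge_ereal_sup => _ [P cP <-].
by apply: T_norm_le; exact: MK_bound_T_bound.
Qed.

Lemma A_le_Mweak_norm : (A_const X <= Mweak_norm X)%E.
Proof.
apply: le_ereal_inf_tmp => _ [c bc <-]; apply: ge_ereal_sup => _ [Q cQ <-].
by apply: T_norm_le; exact: Mweak_bound_T_bound.
Qed.

(** Every positive constant above 24^d times the bound is admissible, and
    [Mweak_bound] contains positive constants only; hence the passage through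
    an arbitrary e > 0. *)
Lemma Mweak_norm_le_Astrong : kothe_reflexive X -> saturated X ->
  saturated (kothe_dual X) ->
  (Mweak_norm X <= (24 ^+ d)%:E * Astrong_const X)%E.
Proof.
move=> refl_X satX satX'.
have S0 : (0 <= Astrong_const X)%E := le_trans (A_const_ge0 X) (A_le_Astrong X).
have [Soo|] := eqVneq (Astrong_const X) +oo%E.
  by rewrite Soo gt0_muley ?leey// lte_fin exprn_gt0.
rewrite -ltey => Soo.
have fin : Astrong_const X \is a fin_num by rewrite ge0_fin_numE.
have cubeX : has_cube_indicators X.
  by apply: has_cube_indicators_of_A_const => //; exact: le_lt_trans (A_le_Astrong X) Soo.
have a0 := fine_ge0 S0.
have bT P : cube_family P -> T_bound X P (fine (Astrong_const X)).
  by apply: (Astrong_const_bound HX); rewrite fineK.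
rewrite -(fineK fin) -EFinM; apply/lee_addgt0Pr => e e0.
apply: ereal_inf_lbound; exists (24 ^+ d * fine (Astrong_const X) + e) => //.
apply: (Mweak_bound_of_T_bound refl_X cubeX a0 bT).
  by rewrite ltr_wpDl// mulr_ge0// exprn_ge0.
by rewrite lerDl ltW.
Qed.

Lemma Astrong_le_A (C : R) : kothe_reflexive X -> 1 <= C -> cube_sum_bound X C ->
  (Astrong_const X <= C%:E * A_const X)%E.
Proof.
move=> refl_X C1 sumC; have C0 : 0 < C by exact: lt_le_trans C1.
have [Aoo|] := eqVneq (A_const X) +oo%E.
  by rewrite Aoo gt0_muley ?leey.
rewrite -ltey => Aoo.
have fin : A_const X \is a fin_num by rewrite ge0_fin_numE// A_const_ge0.
rewrite -(fineK fin) -EFinM; apply: ge_ereal_sup => _ [P cP <-].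
apply: T_norm_le; apply: (T_bound_of_cube_sum HX refl_X cP) => //.
- exact: fine_ge0 (A_const_ge0 X).
- by apply: (A_const_bound HX); rewrite fineK.
- exact: ltW.
Qed.

End comparison.

Theorem theoremE (R : realType) (d n : nat) (hd : (0 < d)%N) (hn : (0 < n)%N) :
  exists (Cdn : R) (Ccmp : R -> R), forall (F : scalars) (X : fspace R F d n),
    directional_BFS X -> kothe_reflexive X ->
    saturated X -> saturated (kothe_dual X) ->
    [/\ [/\ MK_bounded X -> in_Astrong X,
            in_Astrong X -> Mweak_bounded X
          & Mweak_bounded X -> in_A X],
        [/\ (A_const X <= Mweak_norm X)%E,
            (Mweak_norm X <= Cdn%:E * Astrong_const X)%E
          & (Astrong_const X <= MK_norm X)%E]
      & forall C : R, 1 <= C -> cube_sum_bound X C ->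
        [/\ (in_Astrong X <-> Mweak_bounded X) /\ (Mweak_bounded X <-> in_A X),
            comparable_by (Ccmp C) (Astrong_const X) (Mweak_norm X),
            comparable_by (Ccmp C) (Mweak_norm X) (A_const X)
          & comparable_by (Ccmp C) (Astrong_const X) (A_const X)]].
Proof.
exists (24 ^+ d), (fun C => 24 ^+ d * C) => F X HX refl_X satX satX'.
have indic := has_cube_indicators_of_A_const HX satX satX'.
have AS := A_le_Astrong X; have A0 := A_const_ge0 X.
have AW := A_le_Mweak_norm HX.
have WS := Mweak_norm_le_Astrong HX refl_X satX satX'.
have SM := Astrong_le_MK_norm HX.
have Mweak_fin : (Mweak_norm X < +oo)%E -> Mweak_bounded X.
  by move=> /ereal_inf_lt[_ [c bc _] _]; exists c.
have k0 : 0 < 24 ^+ d :> R by rewrite exprn_gt0.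
have ab : in_Astrong X -> Mweak_bounded X.
  move=> [_ Soo]; apply: Mweak_fin; apply: le_lt_trans WS _.
  have S0 := le_trans A0 AS.
  by rewrite -(@fineK _ (Astrong_const X)) ?ge0_fin_numE// -EFinM ltry.
have bd : Mweak_bounded X -> in_A X.
  move=> [c bc]; have Aoo : (A_const X < +oo)%E.
    apply: le_lt_trans AW _; apply: le_lt_trans (ltry c).
    by apply: ereal_inf_lbound; exists c.
  by split=> //; exact: indic.
split.
- split=> // -[c bc]; have Soo : (Astrong_const X < +oo)%E.
    apply: le_lt_trans SM _; apply: le_lt_trans (ltry c).
    by apply: ereal_inf_lbound; exists c.
  by split=> //; apply: indic; exact: le_lt_trans AS Soo.
- by [].
move=> C C1 sumC; have SA := Astrong_le_A HX refl_X C1 sumC.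
have C0 : 0 < C by exact: lt_le_trans C1.
have da : in_A X -> in_Astrong X.
  move=> [cubeX Aoo]; split=> //; apply: le_lt_trans SA _.
  by rewrite -(@fineK _ (A_const X)) ?ge0_fin_numE// -EFinM ltry.
have S0 : (0 <= Astrong_const X)%E := le_trans A0 AS.
have W0 : (0 <= Mweak_norm X)%E := le_trans A0 AW.
have k1 : 1 <= 24 ^+ d :> R by rewrite exprn_ege1// ler1n.
have kC (x : \bar R) : (0 <= x)%E -> (x <= (24 ^+ d * C)%:E * x)%E.
  move=> x0; apply: lee_pemull => //; rewrite lee_fin.
  by rewrite -[leLHS]mulr1 ler_pM// ler01.
have kCk (x : \bar R) : (0 <= x)%E -> ((24 ^+ d)%:E * x <= (24 ^+ d * C)%:E * x)%E.
  by move=> x0; apply: lee_wpmul2r => //; rewrite lee_fin ler_peMr// ltW.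
have kCC (x : \bar R) : (0 <= x)%E -> (C%:E * x <= (24 ^+ d * C)%:E * x)%E.
  by move=> x0; apply: lee_wpmul2r => //; rewrite lee_fin ler_peMl// ltW.
have kCW : (C%:E * A_const X <= C%:E * Mweak_norm X)%E.
  by apply: lee_wpmul2l => //; rewrite lee_fin ltW.
have kSA : ((24 ^+ d)%:E * Astrong_const X <= (24 ^+ d * C)%:E * A_const X)%E.
  by rewrite EFinM -muleA; apply: lee_wpmul2l => //; rewrite lee_fin ltW.
split.
- by split; split=> // h; [exact/da/bd | exact/ab/da].
- split; last exact: le_trans WS (kCk _ S0).
  exact: le_trans SA (le_trans kCW (kCC _ W0)).
- split; first exact: le_trans WS kSA.
  exact: le_trans AW (kC _ W0).
- split; first exact: le_trans SA (kCC _ A0).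
  exact: le_trans AS (kC _ S0).
Qed.
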